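(* Let $p$ be a positive integer, let $-p/2\le a<p/2-2$ with $a<1$, let $0<b<1$, and let $h(\kappa)=(1+c_3\kappa)^{c_4}\exp(d\kappa)$ with $c_3>0$ and $c_4,d\in\mathbb{R}$. Let $\pi(\kappa)=\kappa^{a-1}(1-\kappa)^{b-1}h(\kappa)$, $\kappa\in(0,1)$. 1. Suppose that either ($d\ge0$ and $c_4\le-(c_3+1)^2d/c_3$) or ($d<0$ and $c_4\le-d/c_3$), and that in addition $$d+\frac{c_3c_4}{1+c_3}\ge-\left(\frac p2-a-2\right).$$ Then the (generalized) Bayes estimator of $\beta$ with respect to $\pi(\kappa)$ is minimax under quadratic loss if $$\frac{p+2a+2}{3p/2+a}\le b<1 .$$ 2. Suppose that either ($d\ge0$ and $c_4\ge-d/c_3$) or ($d<0$ and $c_4>-(c_3+1)^2d/c_3$), and that in addition $$d+\frac{c_3c_4}{1+c_3}\le\frac{p/2-a-2}{2}.$$ Then the (generalized) Bayes estimator of $\beta$ with respect to $\pi(\kappa)$ is minimax under quadratic loss if $$\frac{p+2a+2+2\{d+c_3c_4/(1+c_3)\}}{3p/2+a}\le b<1 .$$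
   Context: Model: $y\mid\beta\sim N_p(\beta,I_p)$, $\beta\mid\kappa\sim N_p(0,\kappa^{-1}(1-\kappa)I_p)$, $\kappa\sim\pi(\kappa)$ on $(0,1)$, where $\pi(\kappa)$ may be improper. The (generalized) Bayes estimator with respect to $\pi$ is $$\hat\beta(y)=\left(1-\frac{\int_0^1\kappa^{p/2+1}\exp(-\kappa\|y\|^2/2)\pi(\kappa)\,\mathrm{d}\kappa}{\int_0^1\kappa^{p/2}\exp(-\kappa\|y\|^2/2)\pi(\kappa)\,\mathrm{d}\kappa}\right)y .$$ The risk of an estimator $\delta$ is $E_\beta\|\delta(Y)-\beta\|^2$ with $Y\sim N_p(\beta,I_p)$ (quadratic loss). An estimator is minimax if it minimizes the supremum over $\beta\in\mathbb{R}^p$ of the risk among all estimators; the minimax value is $p$, so $\delta$ is minimax if and only if $E_\beta\|\delta(Y)-\beta\|^2\le p$ for all $\beta\in\mathbb{R}^p$. *)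

(* Defs.v *)
From HB Require Import structures.
From mathcomp Require Import all_boot all_order all_algebra.
From mathcomp Require Import all_classical all_reals all_analysis.

Set Implicit Arguments.
Unset Strict Implicit.
Unset Printing Implicit Defensive.

Import Order.TTheory GRing.Theory Num.Theory.
Import numFieldNormedType.Exports.

Local Open Scope classical_set_scope.
Local Open Scope ring_scope.

(* The points of R^n are the [n.-tuple R], which the library equips with the
   product sigma-algebra (the Borel one). The head is taken in
   [measurableTypeR R], the copy of R on which [normal_prob] is defined: its
   measurable sets are the same, only the display differs. *)
Definition cons_pair {R : realType} (n : nat)
  (u : measurableTypeR R * n.-tuple R) : n.+1.-tuple R := [tuple of u.1 :: u.2].

Lemma measurable_cons_pair {R : realType} (n : nat) :
  measurable_fun setT (@cons_pair R n).
Proof.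
apply: (@measurable_cons _ _ _ R fst n snd); last exact: measurable_snd.
exact: (@measurable_fst _ _ (measurableTypeR R)).
Qed.

HB.instance Definition _ {R : realType} (n : nat) :=
  isMeasurableFun.Build _ _ _ _ (@cons_pair R n) (@measurable_cons_pair R n).

Definition prod_cons {R : realType} (n : nat)
    (P : probability (measurableTypeR R) R) (Q : probability (n.-tuple R) R) :
    probability (n.+1.-tuple R) R :=
  distribution (P \x Q)%E (@cons_pair R n).

(* The normal distribution N_n(beta, I_n), as the n-fold product of the
   N(beta_i, 1); the second parameter of [normal_prob] is the standard
   deviation. *)
Fixpoint mvnormal {R : realType} (n : nat) :
    n.-tuple R -> probability (n.-tuple R) R :=
  match n with
  | 0 => fun=> \d_([tuple] : 0.-tuple R)
  | m.+1 => fun beta =>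
      prod_cons (normal_prob (thead beta) 1) (mvnormal (behead_tuple beta))
  end.

Lemma mvnormal_rect {R : realType} (n : nat) (beta : n.-tuple R)
    (A : 'I_n -> set (measurableTypeR R)) :
  (forall i, measurable (A i)) ->
  mvnormal beta [set y | forall i, A i (tnth y i)] =
  (\prod_(i < n) normal_prob (tnth beta i) 1 (A i))%E.
Proof.
elim: n => [|n IH] in beta A *.
  move=> _; rewrite big_ord0 /= diracE mem_set//= => -[].
  by case.
move=> mA; rewrite big_ord_recl/= /distribution /pushforward/=.
rewrite (_ : _ @^-1` _ = A ord0 `*`
    [set y | forall i, A (lift ord0 i) (tnth y i)]); last first.
  apply/seteqP; split => -[x y] /= => [H|[H0 H] i].
    by split=> [|i]; [exact: (H ord0)|rewrite -(tnthS x y)//; exact: H].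
  case: (unliftP ord0 i) => [j|] ->; last exact: H0.
  by rewrite /cons_pair tnthS; exact: H.
rewrite product_measure1E//; last first.
  rewrite (_ : [set _ | _] =
      \bigcap_(i in [set: 'I_n]) (@tnth n R ^~ i) @^-1` (A (lift ord0 i))).
    apply: fin_bigcap_measurable => // i _.
    rewrite -[X in measurable X]setTI.
    by apply: (@measurable_tnth _ R n i) => //; exact: mA.
  by apply/seteqP; split => y H i; [move=> _; exact: H|exact: (H i Logic.I)].
congr (_ * _)%E.
transitivity (\prod_(i < n)
    normal_prob (tnth (behead_tuple beta) i) 1 (A (lift ord0 i)))%E.
  exact: (IH (behead_tuple beta) (fun i => A (lift ord0 i))).
apply: eq_bigr => i _; congr normal_prob.
by rewrite [in RHS](tuple_eta beta) tnthS.
Qed.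

Section decision_theory.
Context {R : realType} (p : nat).
Implicit Types (beta y : p.-tuple R) (delta : p.-tuple R -> p.-tuple R).

Definition sqnorm y : R := \sum_(i < p) tnth y i ^+ 2.

Definition quadratic_loss (x beta : p.-tuple R) : R :=
  sqnorm [tuple tnth x i - tnth beta i | i < p].

Definition risk delta beta : \bar R :=
  ('E_(mvnormal beta)[fun y => quadratic_loss (delta y) beta])%E.

Definition sup_risk delta : \bar R := ereal_sup (range (risk delta)).

Definition minimax delta : Prop :=
  measurable_fun setT delta /\
  forall delta', measurable_fun setT delta' ->
    (sup_risk delta <= sup_risk delta')%E.

Definition posterior_integral (pi : R -> R) (e : R) y : \bar R :=
  (\int[lebesgue_measure]_(k in `]0%R, 1%R[)
     (k `^ e * expR (- k * sqnorm y / 2) * pi k)%:E)%E.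

(* The ratio is taken in the extended reals: it vanishes when the numerator is
   finite and the denominator diverges. *)
Definition bayes_estimator (pi : R -> R) y : p.-tuple R :=
  let shrink := fine (posterior_integral pi (p%:R / 2 + 1) y /
                      posterior_integral pi (p%:R / 2) y)%E in
  [tuple (1 - shrink) * tnth y i | i < p].

End decision_theory.

Definition prior {R : realType} (a b c3 c4 d : R) (k : R) : R :=
  let h := (1 + c3 * k) `^ c4 * expR (d * k) in
  k `^ (a - 1) * (1 - k) `^ (b - 1) * h.

(* Main.v *)
(* Write m_j(w) for the integral of k^j k^(p/2+a-1) (1-k)^(b-1) h(k) exp(-k w),
   with w = |y|^2/2, so that the estimator is (1 - m_1/m_0) y. By Stein's lemma
   its risk is at most p as soon as w (2 m_2 m_0 - m_1^2) <= p m_0 m_1 for w >= 0.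
   Since b < 1, integration by parts in k is done against k^n (1 - k);
   for n = 1 it makes e^(bw) (b w m_2 - A m_1) nonincreasing past w = (A + b)/b,
   where A is 1 + p/2 + a plus a correction for k h'(k)/h(k), and this gives
   b w m_2 <= A m_1. When w m_1 >= (p/2 + a) m_0 the inequality follows from that
   bound; otherwise from the case n = 0 or, if k h'(k)/h(k) is nonincreasing and
   too negative, from the bound on m_2 again with A sharpened by a monotone
   association argument.
   That no estimator does better than p comes from the priors N(0, tau^2 I): each
   coordinate contributes at least tau^2/(1 + tau^2) to the average risk. *)
Require Import Defs.
From mathcomp Require Import all_boot all_order all_algebra.
From mathcomp Require Import all_classical all_reals all_analysis.
From mathcomp Require Import measurable_realfun ring lra.
Import Order.TTheory GRing.Theory Num.Theory.
Import numFieldNormedType.Exports.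
Local Open Scope classical_set_scope.
Local Open Scope ring_scope.

(** * Integrals over exhausted domains *)

(** The factor [1 - k] in the integrations by parts is dictated by [b < 1]: the density is unbounded
    at 1, and only with one more power of [1 - k] do the boundary terms vanish. The price is that
    the identities involve differences of consecutive moments. The weight exp(bw) is the integrating
    factor for which the n = 1 identity bounds the derivative of exp(bw) (bw m_2 - A m_1) by
    -exp(bw) (1 - b) m_2 (bw - A - b). Since this argument moves along t up to w, the correction
    inside A must be controlled at every t <= w. When A is sharpened by a quantity read off at w
    alone, the association argument carries the estimate back to smaller t. Write s = p/2 + a and c
    = max(0, h'(1)/h(1)), so that c = 0 in part 1. The threshold on [b] is then 2 (s + 1 + c) <= b
    (p + s), which is what remains when w m_1 >= s m_0 is inserted together with the bound on m_2.
    For a = -p/2 the denominator of the estimator is infinite and the estimator is y itself; this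
    case is treated apart. *)

Section exhaustion.
Context {R : realType}.
Notation mu := (@lebesgue_measure R).
Variables (D : set R) (f F : R -> R) (a_ b_ : nat -> R).
Hypothesis mD : measurable D.
Hypothesis ab : forall n, a_ n < b_ n.
Hypothesis abD : forall n, `[a_ n, b_ n] `<=` D.
Hypothesis Dab : forall x, D x -> \forall n \near \oo, a_ n <= x <= b_ n.
Hypothesis mf : measurable_fun D f.
Hypothesis cf : forall x, D x -> {for x, continuous f}.
Hypothesis dF : forall x, D x -> is_derive x 1 F (f x).

Let fn n : R -> R := f \_ `[a_ n, b_ n].

Let integral_fn n :
  (\int[mu]_(x in D) (fn n x)%:E = (F (b_ n) - F (a_ n))%:E)%E.
Proof.
rewrite -[X in integral _ _ X]/(EFin \o (f \_ `[a_ n, b_ n])) -restrict_EFin.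
rewrite -integral_mkcondr setIidr//.
have dF' x : x \in `[a_ n, b_ n] -> derivable F x 1.
  by move=> xab; have [] := dF x (abD n x xab).
have cF : {within `[a_ n, b_ n], continuous F}.
  exact: derivable_within_continuous.
rewrite (@continuous_FTC2 _ f F) //.
- apply/continuous_in_subspaceT => x; rewrite inE => /abD; exact: cf.
- split => [x xab||].
  + by apply: dF'; exact: subset_itv_oo_cc xab.
  + by move/(continuous_within_itvP _ (ab n)) : cF => [].
  + by move/(continuous_within_itvP _ (ab n)) : cF => [].
- move=> x xab; rewrite derive1E.
  by have [_] := dF x (abD n x (subset_itv_oo_cc xab)).
Qed.

Let mfn n : measurable_fun D (EFin \o fn n).
Proof.
apply/measurable_EFinP.
apply/(measurable_restrict f) => //.
by apply: measurable_funS mf => //; exact: subIsetl.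
Qed.

Let fnf x : D x -> (fn n x)%:E @[n --> \oo] --> (f x)%:E.
Proof.
move=> Dx; apply: cvg_near_cst; apply: filterS (Dab x Dx) => n abx.
by rewrite /fn patchE mem_set// in_itv.
Qed.

(** The fundamental theorem of calculus applies on each compact [[a_ n, b_ n]]; the restrictions of
    [f] are dominated by its absolute value, so dominated convergence passes to [D]. This serves
    integrands singular at an end of [D], and the whole line. *)
Lemma integral_exhaustion (L : R) : mu.-integrable D (EFin \o f) ->
  F (b_ n) - F (a_ n) @[n --> \oo] --> L -> \int[mu]_(x in D) f x = L.
Proof.
move=> intf FL.
have aefn : {ae mu, forall x, D x ->
    (fun n => (fn n x)%:E) @ \oo --> (EFin \o f) x} by apply: aeW => x /fnf.
have lefn : {ae mu, forall x n, D x ->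
    (`|(fn n x)%:E| <= (abse \o (EFin \o f)) x)%E}.
  apply: aeW => x n Dx /=; rewrite lee_fin /fn patchE; case: ifPn => // _.
  by rewrite normr0.
have [_ _] := @dominated_convergence _ _ _ mu D mD (fun n => EFin \o fn n) _ _
  mfn (measurable_int _ intf) aefn (integrable_abse intf) lefn.
have E : (fun n => (F (b_ n) - F (a_ n))%:E) =
    (fun n => \int[mu]_(x in D) (EFin \o fn n) x)%E.
  by apply/funext => n; rewrite -integral_fn.
have : (F (b_ n) - F (a_ n))%:E @[n --> \oo] --> L%:E.
  by apply: cvg_EFin => //; exact: nearW.
rewrite E => FL' fL; have := cvg_unique (@ereal_hausdorff R) fL FL'.
by rewrite /Rintegral => ->.
Qed.

(** For nonnegative [f] even integrability comes from the antiderivative: Fatou's lemma bounds the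
    integral by the limit of the increments. *)
Lemma ge0_integrable_exhaustion (L : R) : (forall x, D x -> 0 <= f x) ->
  F (b_ n) - F (a_ n) @[n --> \oo] --> L -> mu.-integrable D (EFin \o f).
Proof.
move=> f0 FL; apply/integrableP; split; first exact/measurable_EFinP.
have f0' n x : D x -> (0 <= (fn n x)%:E)%E.
  by move=> Dx; rewrite lee_fin /fn patchE; case: ifP => // _; exact: f0.
have := fatou mu mD mfn f0'.
under eq_integral => x /[!inE] Dx.
  rewrite (cvg_limn_einf_sup (fnf _ Dx)).1 -(ger0_norm (f0 _ Dx)).
  over.
move=> /le_lt_trans; apply.
rewrite [X in limn_einf X](_ : _ = fun n => (F (b_ n) - F (a_ n))%:E); last first.
  by apply/funext => n; exact: integral_fn.
rewrite (@cvg_limn_einf_sup _ _ L%:E _).1 ?ltry//.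
by apply: cvg_EFin => //; exact: nearW.
Qed.

End exhaustion.

(** * Beta-type weights on the unit interval *)

Section powers.
Context {R : realType}.
Notation mu := (@lebesgue_measure R).
Implicit Types (s b x : R).

Lemma is_derive_powR s x : 0 < x -> is_derive x 1 (@powR R ^~ s) (s * x `^ (s - 1)).
Proof.
move=> x0; have x0' : x \in `]0, +oo[ by rewrite in_itv/= x0.
apply: DeriveDef; first exact: derivable_powR.
by rewrite -derive1E powR_derive1.
Qed.

Lemma is_derive_powR_onem s x : x < 1 ->
  is_derive x 1 (fun x => (1 - x) `^ s) (- (s * (1 - x) `^ (s - 1))).
Proof.
move=> x1; have x0 : 0 < 1 - x by rewrite subr_gt0.
have := @is_derive1_comp _ (@powR R ^~ s) (fun x => 1 - x) x _ _
  (is_derive_powR s _ x0) _.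
move=> /(_ (-1) _); rewrite mulrN1; apply.
by rewrite -[X in is_derive _ _ _ X]add0r; exact: is_deriveB.
Qed.

Lemma continuous_powR s x : 0 < x -> {for x, continuous (@powR R ^~ s)}.
Proof.
by move=> x0; apply/differentiable_continuous/derivable1_diffP;
   have [] := is_derive_powR s x x0.
Qed.

Lemma continuous_powR_onem s x : x < 1 ->
  {for x, continuous (fun x => (1 - x) `^ s)}.
Proof.
by move=> x0; apply/differentiable_continuous/derivable1_diffP;
   have [] := is_derive_powR_onem s x x0.
Qed.

Lemma measurable_powR_onem s : measurable_fun setT (fun x => (1 - x) `^ s).
Proof.
apply: (@measurableT_comp _ _ _ _ _ _ (@powR R ^~ s)) => //.
exact: measurable_funB.
Qed.

Lemma powR_le1D r x : 2^-1 <= x <= 1 -> x `^ r <= 1 + 2^-1 `^ r.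
Proof.
move=> /andP[x2 x1]; have x0 : 0 < x by rewrite (lt_le_trans _ x2).
have [r0|r0] := leP 0 r.
  rewrite (@le_trans _ _ 1) ?lerDl ?powR_ge0//.
  rewrite -[leRHS](_ : 1 `^ r = 1); last by rewrite powR1.
  by apply: ge0_ler_powR => //; rewrite nnegrE// ltW.
rewrite (@le_trans _ _ (2^-1 `^ r)) ?lerDr//.
rewrite -(opprK r) powRN [leRHS]powRN lef_pV2 ?posrE ?powR_gt0//.
by apply: ge0_ler_powR; rewrite ?nnegrE ?oppr_ge0// ltW.
Qed.

(** The shift by 3 keeps [near0 n] below 1/2, hence below [near1 n], for every [n]. *)
Definition near0 (n : nat) : R := n.+3%:R^-1.
Definition near1 (n : nat) : R := 1 - near0 n.

Lemma near0_gt0 n : 0 < near0 n. Proof. by rewrite invr_gt0. Qed.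

Lemma near0_lt1 n : near0 n < 1.
Proof. by rewrite invf_lt1 ?ltr1n. Qed.

Lemma cvg_near0 : near0 n @[n --> \oo] --> (0 : R).
Proof.
rewrite (_ : near0 = fun n => harmonic (n + 2)%N).
  by rewrite cvg_shiftn; exact: cvg_harmonic.
by apply/funext => n; rewrite /near0 /harmonic/= addn2.
Qed.

Lemma near0_near1 n : near0 n < near1 n.
Proof.
rewrite /near1 ltrBrDr -mulr2n -mulr_natr mulrC /near0 ltr_pdivrMr// mul1r.
by rewrite ltr_nat.
Qed.

Lemma near01_subset n : `[near0 n, near1 n] `<=` `]0%R, 1%R[.
Proof.
move=> x /=; rewrite !in_itv/= => /andP[a b].
rewrite (lt_le_trans (near0_gt0 n) a) (le_lt_trans b)//.
by rewrite /near1 ltrBlDr ltrDl near0_gt0.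
Qed.

Lemma near01_exhaust x : `]0%R, 1%R[%classic x ->
  \forall n \near \oo, near0 n <= x <= near1 n.
Proof.
rewrite /= in_itv/= => /andP[x0 x1]; near=> n; apply/andP; split.
  apply: ltW; near: n; apply: (cvgr_lt _ cvg_near0); exact: x0.
rewrite /near1 lerBrDl -lerBrDr; apply: ltW; near: n.
by apply: (cvgr_lt _ cvg_near0); rewrite subr_gt0.
Unshelve. all: by end_near. Qed.

Lemma cvg_near0_powR s : 0 < s -> near0 n `^ s @[n --> \oo] --> (0 : R).
Proof.
move=> s0; have := powR_cvg0 s0; move=> /cvg_at_rightP; apply; split.
  by move=> n; exact: near0_gt0.
exact: cvg_near0.
Qed.

End powers.

Section beta_weight.
Context {R : realType}.
Notation mu := (@lebesgue_measure R).
Notation I01 := (`]0%R, 1%R[%classic : set R).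
Implicit Types (s b x : R).

Lemma integral_powR01 s : 0 < s ->
  mu.-integrable I01 (EFin \o (fun x => x `^ (s - 1))) /\
  \int[mu]_(x in I01) (x `^ (s - 1)) = s^-1.
Proof.
move=> s0.
have mf : measurable_fun I01 (fun x => x `^ (s - 1)).
  by apply: measurable_funTS; exact: measurable_powR.
have cf x : I01 x -> {for x, continuous (fun x : R => x `^ (s - 1))}.
  by rewrite /= in_itv/= => /andP[x0 _]; exact: continuous_powR.
have dF x : I01 x -> is_derive x 1 (fun x => s^-1 * x `^ s) (x `^ (s - 1)).
  rewrite /= in_itv/= => /andP[x0 _].
  have := @is_deriveZ _ _ _ _ s^-1 _ _ _ (is_derive_powR s x x0).
  by rewrite scalerA mulVf ?gt_eqF// scale1r.
have c1 : (near1 n : R) `^ s @[n --> \oo] --> (1 : R).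
  rewrite -[X in _ --> X](_ : (1 - 0) `^ s = 1); last by rewrite subr0 powR1.
  apply: (@continuous_cvg _ _ _ _ _ _ (@powR R ^~ s)).
    by apply: continuous_powR; rewrite subr0.
  by apply: cvgB; [exact: cvg_cst|exact: cvg_near0].
have FL : s^-1 * near1 n `^ s - s^-1 * near0 n `^ s @[n --> \oo] --> s^-1.
  rewrite -[X in _ --> X](_ : s^-1 * 1 - s^-1 * 0 = s^-1); last first.
    by rewrite mulr1 mulr0 subr0.
  by apply: cvgB; apply: cvgM; [exact: cvg_cst|exact: c1|exact: cvg_cst|exact: cvg_near0_powR].
have ix := @ge0_integrable_exhaustion _ I01 _ _ _ _ (measurable_itv _)
  near0_near1 near01_subset near01_exhaust mf cf dF _ _ FL.
have {}ix := ix (fun x _ => powR_ge0 _ _).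
split=> //; exact: (@integral_exhaustion _ I01 _ _ _ _ (measurable_itv _)
  near0_near1 near01_subset near01_exhaust mf cf dF _ ix FL).
Qed.

Lemma integrable_powR_onem01 b : 0 < b ->
  mu.-integrable I01 (EFin \o (fun x => (1 - x) `^ (b - 1))).
Proof.
move=> b0.
have mf : measurable_fun I01 (fun x => (1 - x) `^ (b - 1)).
  by apply: measurable_funTS; exact: measurable_powR_onem.
have cf x : I01 x -> {for x, continuous (fun x : R => (1 - x) `^ (b - 1))}.
  by rewrite /= in_itv/= => /andP[_ x0]; exact: continuous_powR_onem.
have dF x : I01 x -> is_derive x 1 (fun x => (- b^-1) * (1 - x) `^ b) ((1 - x) `^ (b - 1)).
  rewrite /= in_itv/= => /andP[_ x0].
  have := @is_deriveZ _ _ _ _ (- b^-1) _ _ _ (is_derive_powR_onem b x x0).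
  by rewrite scalerN scaleNr opprK scalerA mulVf ?gt_eqF// scale1r.
have c1 : (1 - near0 n : R) `^ b @[n --> \oo] --> (1 : R).
  rewrite -[X in _ --> X](_ : (1 - 0) `^ b = 1); last by rewrite subr0 powR1.
  apply: (@continuous_cvg _ _ _ _ _ _ (@powR R ^~ b)).
    by apply: continuous_powR; rewrite subr0.
  by apply: cvgB; [exact: cvg_cst|exact: cvg_near0].
have FL : (- b^-1) * (1 - near1 n) `^ b - (- b^-1) * (1 - near0 n) `^ b @[n --> \oo] --> b^-1.
  rewrite -[X in _ --> X](_ : (- b^-1) * 0 - (- b^-1) * 1 = b^-1); last first.
    by rewrite mulr1 mulr0 sub0r opprK.
  under [X in X @ _ --> _]eq_fun do rewrite /near1 subKr.
  by apply: cvgB; apply: cvgM; [exact: cvg_cst|exact: cvg_near0_powR|exact: cvg_cst|exact: c1].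
exact: (@ge0_integrable_exhaustion _ I01 _ _ _ _ (measurable_itv _)
  near0_near1 near01_subset near01_exhaust mf cf dF _ (fun x _ => powR_ge0 _ _) FL).
Qed.

Definition beta_weight s b x := x `^ (s - 1) * (1 - x) `^ (b - 1).

Lemma beta_weight_ge0 s b x : 0 <= beta_weight s b x.
Proof. by rewrite mulr_ge0 ?powR_ge0. Qed.

Lemma measurable_beta_weight s b : measurable_fun setT (beta_weight s b).
Proof.
apply: measurable_funM; first exact: measurable_powR.
exact: measurable_powR_onem.
Qed.

Lemma beta_weightS s b x : 0 < x -> beta_weight (s + 1) b x = x * beta_weight s b x.
Proof.
move=> x0; rewrite /beta_weight addrK mulrA; congr (_ * _).
rewrite powRB; last by rewrite (gt_eqF x0) implybT.
by rewrite powRr1 ?ltW// mulrCA divff ?mulr1 ?gt_eqF.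
Qed.

(** On each half of the interval the power attached to the far endpoint is bounded, so a sum of two
    one-sided powers dominates. *)
Lemma integrable_beta_weight s b : 0 < s -> 0 < b ->
  mu.-integrable I01 (EFin \o beta_weight s b).
Proof.
move=> s0 b0.
pose g x := (1 + 2^-1 `^ (b - 1)) * x `^ (s - 1) +
            (1 + 2^-1 `^ (s - 1)) * (1 - x) `^ (b - 1).
have ig : mu.-integrable I01 (EFin \o g).
  rewrite (_ : EFin \o g = (fun x => (1 + 2^-1 `^ (b - 1))%:E * (x `^ (s - 1))%:E +
    (1 + 2^-1 `^ (s - 1))%:E * ((1 - x) `^ (b - 1))%:E)%E)//.
  apply: integrableD => //; apply: integrableZl => //.
    exact: (integral_powR01 _ s0).1.
  exact: integrable_powR_onem01.
apply: le_integrable ig => //.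
  by apply/measurable_EFinP/measurable_funTS; exact: measurable_beta_weight.
move=> x; rewrite /= in_itv/= => /andP[x0 x1].
have c0 r : 0 <= 1 + 2^-1 `^ r :> R by rewrite addr_ge0 ?powR_ge0.
rewrite lee_fin !ger0_norm ?beta_weight_ge0//; last first.
  by rewrite addr_ge0// mulr_ge0 ?powR_ge0.
have [x2|x2] := leP x 2^-1.
  rewrite (@le_trans _ _ ((1 + 2^-1 `^ (b - 1)) * x `^ (s - 1)))//.
    rewrite [leRHS]mulrC ler_wpM2l ?powR_ge0// powR_le1D//.
    by apply/andP; split; lra.
  by rewrite lerDl mulr_ge0 ?powR_ge0.
rewrite (@le_trans _ _ ((1 + 2^-1 `^ (s - 1)) * (1 - x) `^ (b - 1)))//.
  rewrite ler_wpM2r ?powR_ge0// powR_le1D//.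
  by apply/andP; split; lra.
by rewrite lerDr mulr_ge0 ?powR_ge0.
Qed.

Lemma integrable_bounded_weight s b (u : R -> R) (M : R) : 0 < s -> 0 < b ->
  measurable_fun I01 u -> (forall x, 0 < x < 1 -> `|u x| <= M) ->
  mu.-integrable I01 (EFin \o (fun x => beta_weight s b x * u x)).
Proof.
move=> s0 b0 mu' uM.
have ig : mu.-integrable I01 (fun x => M%:E * (beta_weight s b x)%:E)%E.
  by apply: integrableZl => //; exact: integrable_beta_weight.
apply: le_integrable ig => //.
  apply/measurable_EFinP; apply: measurable_funM => //.
  by apply: measurable_funTS; exact: measurable_beta_weight.
move=> x; rewrite /= in_itv/= => x01.
rewrite lee_fin !normrM mulrC ler_wpM2r ?normr_ge0//.
exact: le_trans (uM _ x01) (ler_norm _).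
Qed.

(* Both endpoint terms of [x ^ s (1 - x) ^ b H x] vanish, even when [b < 1]. *)
Lemma integral_by_parts_weight s b (H dH : R -> R) (M : R) : 0 < s -> 0 < b ->
  (forall x, 0 < x < 1 -> is_derive x 1 H (dH x)) ->
  (forall x, 0 < x < 1 -> {for x, continuous dH}) ->
  (forall x, 0 < x < 1 -> `|H x| <= M) ->
  (forall x, 0 < x < 1 -> `|dH x| <= M) ->
  \int[mu]_(x in I01) (beta_weight s b x *
     ((s * (1 - x) - b * x) * H x + x * (1 - x) * dH x)) = 0.
Proof.
move=> s0 b0 dHx cdH HM dHM.
have cH x : 0 < x < 1 -> {for x, continuous H}.
  move=> x01; apply/differentiable_continuous/derivable1_diffP.
  by have [] := dHx x x01.
pose v x := (s * (1 - x) - b * x) * H x + x * (1 - x) * dH x.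
have cv x : 0 < x < 1 -> {for x, continuous v}.
  move=> x01; apply: cvgD; apply: cvgM; [|exact: cH| |exact: cdH].
    apply: cvgB; apply: cvgM; [exact: cvg_cst| |exact: cvg_cst|exact: cvg_id].
    by apply: cvgB; [exact: cvg_cst|exact: cvg_id].
  apply: cvgM; [exact: cvg_id|].
  by apply: cvgB; [exact: cvg_cst|exact: cvg_id].
have mv : measurable_fun I01 v.
  apply: open_continuous_measurable_fun => // x.
  by rewrite inE/= in_itv/=; exact: cv.
have vM x : 0 < x < 1 -> `|v x| <= (s + b) * M + M.
  move=> x01; have := HM x x01; have := dHM x x01; case/andP : x01 => x0 x1 dHM' HM'.
  rewrite (le_trans (ler_normD _ _))// lerD// normrM.
    apply: ler_pM => //; rewrite ler_norml; apply/andP; split; nra.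
  rewrite -[leRHS]mul1r; apply: ler_pM => //.
  by rewrite ler_norml; apply/andP; split; nra.
have ig := integrable_bounded_weight s b v _ s0 b0 mv vM.
pose F x := x `^ s * (1 - x) `^ b * H x.
have dF x : I01 x -> is_derive x 1 F (beta_weight s b x * v x).
  rewrite /= in_itv/= => x01; have /andP[x0 x1] := x01.
  have d1 := is_derive_powR s x x0.
  have d2 := is_derive_powR_onem b x x1.
  have d3 := dHx x x01.
  have := @is_deriveM _ _ _ _ _ _ _ _ (@is_deriveM _ _ _ _ _ _ _ _ d1 d2) d3.
  rewrite /GRing.scale/=.
  set D := (X in is_derive _ _ _ X -> _).
  suff -> : beta_weight s b x * v x = D by [].
  rewrite /D /v /beta_weight !fctE /=.
  have -> : x `^ s = x * x `^ (s - 1) by rewrite mulr_powRB1 ?ltW.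
  have -> : (1 - x) `^ b = (1 - x) * (1 - x) `^ (b - 1).
    by rewrite mulr_powRB1// subr_ge0 ltW.
  by ring.
(* One bound for each end: the first makes [F] vanish at 0, the second at 1. *)
have F0 x : 0 < x < 1 -> `|F x| <= M * x `^ s /\ `|F x| <= M * (1 - x) `^ b.
  move=> x01; have := HM x x01; have /andP[x0 x1] := x01 => HM'.
  have le1 r y : 0 < r -> 0 < y < 1 -> y `^ r <= 1.
    move=> r0 /andP[y0 y1]; rewrite -[leRHS](_ : 1 `^ r = 1); last by rewrite powR1.
    by apply: ge0_ler_powR; rewrite ?nnegrE ?ltW.
  have x01' : 0 < 1 - x < 1 by apply/andP; split; lra.
  have aux (A q h : R) : 0 <= A -> 0 <= q <= 1 -> 0 <= h <= M -> A * q * h <= M * A.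
    move=> A0 /andP[q0 q1] /andP[h0 hM]; rewrite mulrC; apply: ler_pM => //.
      exact: mulr_ge0.
    by rewrite -[leRHS]mulr1 ler_wpM2l.
  rewrite !normrM !(ger0_norm (powR_ge0 _ _)); split; last rewrite [_ `^ s * _]mulrC.
    by apply: aux; rewrite ?powR_ge0 ?normr_ge0 ?le1.
  by apply: aux; rewrite ?powR_ge0 ?normr_ge0 ?le1.
have n01 n : 0 < (near0 n : R) < 1 by rewrite near0_gt0 near0_lt1.
have n11 n : 0 < (near1 n : R) < 1.
  by rewrite subr_gt0 near0_lt1 ltrBlDr ltrDl near0_gt0.
have FL : F (near1 n) - F (near0 n) @[n --> \oo] --> (0 : R).
  rewrite -[X in _ --> X](subr0 0); apply: cvgB.
    apply: norm_cvg0; apply: (@squeeze_cvgr _ _ _ _ (cst 0) (fun n => M * near0 n `^ b)).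
    - apply: nearW => n; rewrite normr_ge0/=.
      have [_] := F0 _ (n11 n).
      by rewrite /near1 subKr.
    - exact: cvg_cst.
    - by rewrite -(mulr0 M); apply: cvgM; [exact: cvg_cst|exact: cvg_near0_powR].
  apply: norm_cvg0; apply: (@squeeze_cvgr _ _ _ _ (cst 0) (fun n => M * near0 n `^ s)).
  - apply: nearW => n; rewrite normr_ge0/=.
    by have [] := F0 _ (n01 n).
  - exact: cvg_cst.
  - by rewrite -(mulr0 M); apply: cvgM; [exact: cvg_cst|exact: cvg_near0_powR].
apply: (@integral_exhaustion _ I01 _ F _ _ (measurable_itv _)
  near0_near1 near01_subset near01_exhaust _ _ dF _ ig FL).
  by have /measurable_int/measurable_EFinP := ig.
move=> x; rewrite /= in_itv/= => x01; have /andP[x0 x1] := x01.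
apply: cvgM; last exact: cv.
by apply: cvgM; [exact: continuous_powR|exact: continuous_powR_onem].
Qed.

End beta_weight.

(** * Exponential tilting of a weight *)

Section bounded_measurable.
Context {R : realType}.
Notation I01 := (`]0%R, 1%R[%classic : set R).
Implicit Types u v : R -> R.

(** The multipliers allowed under the weight: bounded ones are integrable against every
    [beta_weight] with positive parameters, and the class is closed under the operations that build
    the integrands. *)
Definition bounded_measurable01 u := measurable_fun I01 u /\
  exists M : R, forall x, 0 < x < 1 -> `|u x| <= M.

Lemma bm01_cst (c : R) : bounded_measurable01 (fun=> c).
Proof. by split; [exact: measurable_cst|exists `|c|]. Qed.

Lemma bm01_id : bounded_measurable01 (fun x => x).
Proof.
split; first exact: measurable_id.
by exists 1 => x /andP[x0 x1]; rewrite ger0_norm ltW.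
Qed.

Lemma bm01D u v : bounded_measurable01 u -> bounded_measurable01 v ->
  bounded_measurable01 (fun x => u x + v x).
Proof.
move=> [mu [M uM]] [mv [N vN]]; split; first exact: measurable_funD.
exists (M + N) => x x01; rewrite (le_trans (ler_normD _ _))// lerD//.
  exact: uM.
exact: vN.
Qed.

Lemma bm01M u v : bounded_measurable01 u -> bounded_measurable01 v ->
  bounded_measurable01 (fun x => u x * v x).
Proof.
move=> [mu [M uM]] [mv [N vN]]; split; first exact: measurable_funM.
by exists (M * N) => x x01; rewrite normrM ler_pM ?uM ?vN.
Qed.

Lemma bm01N u : bounded_measurable01 u -> bounded_measurable01 (fun x => - u x).
Proof.
move=> [mu [M uM]]; split; first exact: measurableT_comp.
by exists M => x x01; rewrite normrN uM.
Qed.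

Lemma bm01_expR (w : R) : bounded_measurable01 (fun x => expR (- (x * w))).
Proof.
split.
  apply: measurableT_comp => //; apply: measurableT_comp => //.
  exact: measurable_funM.
exists (expR `|w|) => x /andP[x0 x1]; rewrite ger0_norm ?expR_ge0// ler_expR.
rewrite (le_trans (ler_norm _))// normrN normrM (ger0_norm (ltW x0)).
by rewrite ler_piMl ?normr_ge0// ltW.
Qed.

Lemma bm01_exprn (n : nat) : bounded_measurable01 (fun x : R => x ^+ n).
Proof.
split; first exact: measurable_funX.
by exists 1 => x /andP[x0 x1]; rewrite normrX exprn_ile1// ger0_norm// ltW.
Qed.

End bounded_measurable.

Ltac bm01 := repeat first
  [ assumption | exact: bm01_cst | exact: bm01_id | exact: bm01_expR
  | exact: bm01_exprn  | apply: bm01D | apply: bm01N | apply: bm01M ].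

Section tilted_integral.
Context {R : realType}.
Notation mu := (@lebesgue_measure R).
Notation I01 := (`]0%R, 1%R[%classic : set R).
Variables (s b : R) (h : R -> R).
Hypotheses (s_gt0 : 0 < s) (b_gt0 : 0 < b) (bm_h : bounded_measurable01 h).
Hypothesis h_ge0 : forall x, 0 < x < 1 -> 0 <= h x.
Implicit Types (u v : R -> R) (w : R).

(** An unnormalised posterior expectation of [u], with [w] half the squared norm of the
    observation. *)
Definition tilt w u : R := \int[mu]_(x in I01)
  (beta_weight s b x * (h x * expR (- (x * w)) * u x)).

Lemma integrable_tilt w u : bounded_measurable01 u ->
  mu.-integrable I01
    (EFin \o (fun x => beta_weight s b x * (h x * expR (- (x * w)) * u x))).
Proof.
move=> bu; have [mF [M FM]] : bounded_measurable01
    (fun x => h x * expR (- (x * w)) * u x) by bm01.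
exact: integrable_bounded_weight FM.
Qed.

Lemma eq_tilt w u v : (forall x, 0 < x < 1 -> u x = v x) -> tilt w u = tilt w v.
Proof.
move=> uv; apply: eq_Rintegral => x; rewrite inE/= in_itv/= => x01.
by rewrite uv.
Qed.

Lemma tilt_lin w c d u v : bounded_measurable01 u -> bounded_measurable01 v ->
  tilt w (fun x => c * u x + d * v x) = c * tilt w u + d * tilt w v.
Proof.
move=> bu bv; rewrite /tilt -!RintegralZl//; [|exact: integrable_tilt..].
have iZ e u' : bounded_measurable01 u' -> mu.-integrable I01 (EFin \o
    (fun x => e * (beta_weight s b x * (h x * expR (- (x * w)) * u' x)))).
  move=> bu'; apply: eq_integrable (integrableZl _ e (integrable_tilt w u' bu')) => //.
rewrite -RintegralD//; [|exact: iZ..].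
by apply: eq_Rintegral => x _; ring.
Qed.

Lemma tilt_ge0 w u : (forall x, 0 < x < 1 -> 0 <= u x) -> 0 <= tilt w u.
Proof.
move=> u0; apply: Rintegral_ge0 => x; rewrite /= in_itv/= => x01.
by rewrite mulr_ge0 ?beta_weight_ge0// mulr_ge0 ?u0// mulr_ge0 ?expR_ge0 ?h_ge0.
Qed.

Lemma le_tilt w u v : bounded_measurable01 u -> bounded_measurable01 v ->
  (forall x, 0 < x < 1 -> u x <= v x) -> tilt w u <= tilt w v.
Proof.
move=> bu bv uv; rewrite -subr_ge0.
rewrite -[X in X - _]mul1r -mulN1r -tilt_lin//; apply: tilt_ge0 => x x01.
by rewrite mul1r mulN1r subr_ge0 uv.
Qed.

(** Differentiation under the integral sign. It holds at every real [w] because [x] stays in a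
    bounded interval: for [t] within 1 of [w] the exponential is at most exp(|w| + 1). *)
Lemma is_derive_tilt w u : bounded_measurable01 u ->
  is_derive w 1 (tilt^~ u) (- tilt w (fun x => x * u x)).
Proof.
move=> bu.
pose f w x := beta_weight s b x * (h x * expR (- (x * w)) * u x).
have df (t x : R) : is_derive t 1 (f ^~ x) (- (x * f t x)).
  have d1 : is_derive t 1 (fun t => - (x * t)) (- x).
    by rewrite -[X in is_derive _ _ _ (- X)]mulr1; apply: is_deriveN; apply: is_deriveZ.
  have d2 := @is_derive1_comp _ expR (fun t => - (x * t)) t _ _
    (is_derive_expR (- (x * t))) d1.
  have -> : f ^~ x = (beta_weight s b x * h x * u x) \*: (expR \o (fun t => - (x * t))).
    by apply/funext => y; rewrite /f /= /GRing.scale /=; ring.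
  apply: is_derive_eq; rewrite /GRing.scale/= /f; ring.
have p1E (t x : R) : partial1of2 f t x = - (x * f t x).
  by rewrite partial1of2E; have [_ ->] := df t x.
have [mF [M FM]] : bounded_measurable01 (fun x => h x * u x) by bm01.
pose G x := `|beta_weight s b x| * (expR (`|w| + 1) * `|M|).
have iG : mu.-integrable I01 (EFin \o G).
  rewrite (_ : EFin \o G = (fun x => (expR (`|w| + 1) * `|M|)%:E * `|(beta_weight s b x)%:E|)%E).
    apply: integrableZl => //; apply: integrable_abse.
    exact: integrable_beta_weight.
  by apply/funext => x; rewrite /G /= mulrC.
have Iw : `]w - 1, w + 1[%classic w by rewrite /= in_itv/=; apply/andP; split; lra.
have intf t : `]w - 1, w + 1[%classic t -> mu.-integrable I01 (EFin \o f t).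
  by move=> _; exact: integrable_tilt.
have derf t x : `]w - 1, w + 1[%classic t -> I01 x -> derivable (f ^~ x) t 1.
  by move=> _ _; have [] := df t x.
have G_ub t x : `]w - 1, w + 1[%classic t -> I01 x -> `|partial1of2 f t x| <= G x.
  rewrite /= !in_itv/= => /andP[v1 v2] x01; have /andP[x0 x1] := x01.
  rewrite p1E normrN /f /G !normrM mulrCA ler_wpM2l// -[h x]mulr1.
  have -> : `|x| * (`|h x * 1| * `|expR (- (x * t))| * `|u x|) =
     `|x| * `|expR (- (x * t))| * `|h x * u x| by rewrite mulr1 normrM; ring.
  apply: ler_pM => //; last exact: le_trans (FM _ x01) (ler_norm _).
  rewrite -[leRHS]mul1r; apply: ler_pM => //; first by rewrite ger0_norm ltW.
  rewrite ger0_norm ?expR_ge0// ler_expR.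
  rewrite (le_trans (ler_norm _))// normrN normrM (ger0_norm (ltW x0)).
  rewrite (@le_trans _ _ `|t|)//; first by rewrite ler_piMl ?normr_ge0// ltW.
  rewrite -[t](subrK w) addrC (le_trans (ler_normD _ _))// lerD2l.
  by rewrite ler_norml; apply/andP; split; lra.
have G0 x : 0 <= G x by rewrite !mulr_ge0 ?expR_ge0.
have mI : measurable I01 by exact: measurable_itv.
have -> : tilt^~ u = (fun t => \int[mu]_(x in I01) f t x) by [].
apply: DeriveDef.
  refine (@derivable_under_integral R _ (measurableTypeR R) mu f I01 mI w
    _ _ Iw intf derf G G0 iG G_ub).
rewrite -derive1E (@differentiation_under_integral R _ (measurableTypeR R) mu f I01 mI w
  _ _ Iw intf derf G G0 iG G_ub).
rewrite -[RHS]mulN1r /tilt -RintegralZl//; last by apply: integrable_tilt; bm01.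
by apply: eq_Rintegral => x _; rewrite p1E /f; ring.
Qed.

(** Apply the weighted integration by parts to H = h exp(-xw) v, whose derivative is h exp(-xw) ((g
    - w) v + v'). *)
Lemma integral_by_parts_tilt w (g v dv : R -> R) :
  (forall x : R, 0 < x < 1 -> is_derive x 1 h (g x * h x)) ->
  (forall x : R, 0 < x < 1 -> {for x, continuous g}) ->
  (forall x : R, 0 < x < 1 -> is_derive x 1 v (dv x)) ->
  (forall x : R, 0 < x < 1 -> {for x, continuous dv}) ->
  bounded_measurable01 g ->
  bounded_measurable01 v -> bounded_measurable01 dv ->
  tilt w (fun x => (s * (1 - x) - b * x) * v x +
                   x * (1 - x) * ((g x - w) * v x + dv x)) = 0.
Proof.
move=> dh cg dvx cdv bg bv bdv.
have [_ [M1 HM]] : bounded_measurable01 (fun x => h x * expR (- (x * w)) * v x) by bm01.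
have [_ [M2 dHM]] : bounded_measurable01
   (fun x => h x * expR (- (x * w)) * ((g x - w) * v x + dv x)) by bm01.
have cont (f : R -> R) (df x : R) : is_derive x 1 f df -> {for x, continuous f}.
  by move=> [+ _]; move=> ?; apply/differentiable_continuous/derivable1_diffP.
have de (x : R) : is_derive x 1 (fun x => expR (- (x * w))) (- w * expR (- (x * w))).
  have d1 : is_derive x 1 (fun x => - (x * w)) (- w).
    rewrite (_ : (fun x => - (x * w)) = fun x => - (w * x)).
      by rewrite -[X in is_derive _ _ _ (- X)]mulr1; apply: is_deriveN; apply: is_deriveZ.
    by apply/funext => y; rewrite mulrC.
  have := @is_derive1_comp _ expR (fun x => - (x * w)) x _ _
    (is_derive_expR (- (x * w))) d1.
  by rewrite mulrC.
transitivity (\int[mu]_(x in I01) (beta_weight s b x *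
     ((s * (1 - x) - b * x) * (h x * expR (- (x * w)) * v x) + x * (1 - x) *
     (h x * expR (- (x * w)) * ((g x - w) * v x + dv x))))).
  by apply: eq_Rintegral => x _; ring.
apply: (@integral_by_parts_weight _ s b _ _ (Num.max M1 M2)) => // x x01.
- have := @is_deriveM _ _ _ _ _ _ _ _
    (@is_deriveM _ _ _ _ _ _ _ _ (dh x x01) (de x)) (dvx x x01).
  by rewrite /GRing.scale/= !fctE/= => d; apply: is_derive_eq; ring.
- have ch := cont _ _ _ (dh x x01).
  have ce := cont _ _ _ (de x).
  have cv := cont _ _ _ (dvx x x01).
  apply: cvgM; first by apply: cvgM; [exact: ch|exact: ce].
  apply: cvgD; last exact: cdv.
  apply: cvgM; last exact: cv.
  by apply: cvgB; [exact: cg|exact: cvg_cst].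
- by rewrite le_max HM.
- by rewrite le_max dHM ?orbT.
Qed.

End tilted_integral.

(** * The moment inequality *)

Section moment_inequality.
Context {R : realType}.
Variables (s b : R) (h g : R -> R).
Hypotheses (s_gt0 : 0 < s) (b_gt0 : 0 < b) (b_lt1 : b < 1).
Hypotheses (bm_h : bounded_measurable01 h) (bm_g : bounded_measurable01 g).
Hypothesis h_ge0 : forall x : R, 0 < x < 1 -> 0 <= h x.
Hypothesis dh : forall x : R, 0 < x < 1 -> is_derive x 1 h (g x * h x).
Hypothesis cg : forall x : R, 0 < x < 1 -> {for x, continuous g}.
Implicit Types (w t : R).

Notation E := (tilt s b h).
Definition moment w (n : nat) := tilt s b h w (fun x => x ^+ n).
Notation m := moment.

Lemma moment_ge0 w n : 0 <= m w n.
Proof. by apply: tilt_ge0 => // x /andP[/ltW x0 _]; exact: exprn_ge0. Qed.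

Lemma moment_leS w n : m w n.+1 <= m w n.
Proof.
apply: le_tilt => //; [exact: bm01_exprn..|].
by move=> x /andP[x0 x1]; rewrite exprS ler_piMl ?exprn_ge0// ltW.
Qed.

Lemma is_derive_moment w n : is_derive w 1 (m ^~ n) (- m w n.+1).
Proof.
have -> : m w n.+1 = E w (fun x => x * x ^+ n).
  by apply: eq_tilt => x _; rewrite exprS.
exact: (is_derive_tilt _ _ _ s_gt0 b_gt0 bm_h w _ (bm01_exprn n)).
Qed.

(** Integration by parts with [v = x ^ n]. Every term except the one with [b] carries a factor
    [1 - x], whence the differences of moments. *)
Lemma moment_recurrence w n :
  (s + n%:R) * (m w n - m w n.+1) - b * m w n.+1
    + E w (fun x => x ^+ n * ((1 - x) * (x * g x))) = w * (m w n.+1 - m w n.+2).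
Proof.
have bX := @bm01_exprn R.
have bnX k (c : R) : bounded_measurable01 (fun x : R => c * x ^+ k) by bm01.
have dX (x : R) : 0 < x < 1 -> is_derive x 1 (fun x : R => x ^+ n) (n%:R * x ^+ n.-1).
  move=> _; have := @is_deriveX _ _ (id : R -> R) n x 1 1 (is_derive_id x 1).
  rewrite /GRing.scale/= mulr1.
  suff -> : (id : R -> R) ^+ n = fun x => x ^+ n by [].
  by rewrite exprfctE.
have cX (x : R) : 0 < x < 1 -> {for x, continuous (fun x : R => n%:R * x ^+ n.-1)}.
  by move=> _; apply: cvgM; [exact: cvg_cst|exact: exprn_continuous].
have := integral_by_parts_tilt _ _ _ s_gt0 b_gt0 bm_h w g _ _ dh cg dX cX bm_g
  (bX n) (bnX _ _).
set u := (fun x : R => x ^+ n * _).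
have bu : bounded_measurable01 u by rewrite /u; bm01.
move=> /(congr1 (fun z => - z)); rewrite oppr0.
pose k0 := s + n%:R.
rewrite (@eq_tilt _ _ _ _ w _ (fun x => 1 * (k0 * x ^+ n + (- (k0 + b + w)) * x ^+ n.+1)
   + 1 * (w * x ^+ n.+2 + 1 * u x))); last first.
  move=> x _; rewrite /u /k0 !exprS; case: (n) => [|n'] /=; rewrite ?expr0 ?exprS; ring.
rewrite !tilt_lin//; try by bm01.
rewrite -/(m w n) -/(m w n.+1) -/(m w n.+2) /k0 => H; lra.
Qed.

(** Up to [w1 = (A + b) / b] the recurrence at n = 1 gives the bound at once, since [m t 2 - m t 3]
    is nonnegative. Beyond [w1] the same recurrence makes [psi] nonincreasing. The hypothesis ranges
    over all [t <= w] because the mean value theorem evaluates the derivative at an unknown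
    point. *)
Lemma moment_bound (r w : R) : 0 <= w -> 0 <= s + 1 + r ->
  (forall t, 0 <= t <= w ->
     E t (fun x => x ^+ 1 * ((1 - x) * (x * g x))) <= r * (m t 1 - m t 2)) ->
  b * w * m w 2 <= (s + 1 + r) * m w 1.
Proof.
move=> w0; set A := s + 1 + r => A0 Er.
have rec t : 0 <= t <= w -> A * (m t 1 - m t 2) - b * m t 2 >= t * (m t 2 - m t 3).
  move=> tw; have := moment_recurrence t 1; have := Er t tw.
  by rewrite /A; lra.
pose w1 := (A + b) / b.
have w1b : w1 * b = A + b by rewrite /w1 divfK ?gt_eqF.
have b_ge0 := ltW b_gt0.
have w1_ge0 : 0 <= w1 by rewrite divr_ge0// addr_ge0.
have early t : 0 <= t <= w -> t <= w1 -> b * t * m t 2 <= A * m t 1.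
  move=> tw tw1; have := rec t tw.
  have t0 : 0 <= t by case/andP: tw.
  have h1 : 0 <= t * (m t 2 - m t 3) by rewrite mulr_ge0// subr_ge0 moment_leS.
  have h2 : b * t * m t 2 <= (A + b) * m t 2.
    by rewrite ler_wpM2r ?moment_ge0// -w1b mulrC ler_wpM2r.
  by lra.
have [ww1|w1w] := leP w w1; first by apply: early => //; rewrite w0/=.
(* The exponent [b] is the one for which the terms in [m t 1] cancel once the recurrence is
   substituted into the derivative. *)
pose psi t := expR (b * t) * (b * t * m t 2 - A * m t 1).
pose dpsi t := expR (b * t) * (b * (b * t * m t 2 - A * m t 1) +
  (b * m t 2 - b * t * m t 3 + A * m t 2)).
have d (t : R) : is_derive t 1 psi (dpsi t).
  have d2 := is_derive_moment t 2; have d1 := is_derive_moment t 1.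
  have de : is_derive t 1 (fun t => expR (b * t)) (b * expR (b * t)).
    have d0 : is_derive t 1 (fun t => b * t) b.
      by rewrite -[X in is_derive _ _ _ X]mulr1; apply: is_deriveZ.
    by have := @is_derive1_comp _ expR (fun t => b * t) t _ _
      (is_derive_expR (b * t)) d0; rewrite mulrC.
  have db : is_derive t 1 (fun t => b * t) b.
    by rewrite -[X in is_derive _ _ _ X]mulr1; apply: is_deriveZ.
  have dd := @is_deriveB _ _ _ _ _ _ _ _ _ (@is_deriveM _ _ _ _ _ _ _ _ db d2)
     (@is_deriveZ _ _ _ _ A _ _ _ d1).
  have := @is_deriveM _ _ _ _ _ _ _ _ de dd.
  rewrite /GRing.scale/= !fctE/= => D.
  by apply: (is_derive_eq D); rewrite /dpsi /GRing.scale/=; ring.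
have [c cw] : exists2 c, c \in `]w1, w[%R & psi w - psi w1 = dpsi c * (w - w1).
  apply: MVT => //.
  by apply: continuous_subspaceT => t;
    apply/differentiable_continuous/derivable1_diffP; have [] := d t.
move: cw; rewrite in_itv/= => /andP[w1c cw] psiw.
have dpsi_le0 : dpsi c <= 0.
  rewrite /dpsi pmulr_rle0 ?expR_gt0//.
  have cw' : 0 <= c <= w by rewrite (le_trans w1_ge0)//= ltW.
  have rc := rec c cw'.
  have m2 := moment_ge0 c 2.
  have bc : A + b <= b * c by rewrite -w1b mulrC ler_pM2l// ltW.
  (* By the recurrence, the bracket in [dpsi c] is at most the negative of this product; it is here
     that [b < 1] and [c > w1] enter. *)
  have h1 : 0 <= m c 2 * (1 - b) * (b * c - (A + b)).
    by rewrite !mulr_ge0 ?subr_ge0// ltW.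
  have h2 : b * (c * (m c 2 - m c 3)) <= b * (A * (m c 1 - m c 2) - b * m c 2).
    by rewrite ler_pM2l.
  lra.
have psi1 : psi w1 <= 0.
  rewrite /psi pmulr_rle0 ?expR_gt0// subr_le0; apply: early => //.
  by rewrite w1_ge0/= ltW.
have : psi w <= 0.
  have : dpsi c * (w - w1) <= 0 by rewrite mulr_le0_ge0// subr_ge0 ltW.
  lra.
by rewrite /psi pmulr_rle0 ?expR_gt0// subr_le0.
Qed.

Lemma tilt_shift w t u : E t u = E w (fun x => expR (x * (w - t)) * u x).
Proof.
apply: eq_Rintegral => x _; congr (_ * _).
rewrite !mulrA; congr (_ * _); rewrite -mulrA -expRD; congr (_ * expR _).
ring.
Qed.

(* The sign of [N - r] changes at most once, from negative to positive, and
   passing from [w] to [t] puts more weight on the larger [x]. *)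
Lemma tilt_ge_monotone (N : R -> R) (r w t : R) : bounded_measurable01 N ->
  (forall x y, 0 < x -> x <= y -> y < 1 -> N x <= N y) -> t <= w ->
  0 <= E w (fun x => (1 - x) * (N x - r)) ->
  0 <= E t (fun x => x * ((1 - x) * (N x - r))).
Proof.
move=> bN ndN tw E0.
(* The point 0 is included so that the supremum [z] exists even if [N >= r] throughout; [z] is where
   [N - r] changes sign. *)
pose S := [set x : R | x = 0 \/ 0 < x < 1 /\ N x < r].
have S0 : S 0 by left.
have S1 : ubound S 1 by move=> x [->|[/andP[_ /ltW]]].
have supS : has_sup S by split; [exists 0|exists 1].
pose z := sup S.
have z0 : 0 <= z by exact: (sup_upper_bound supS).
have Nlt x : 0 < x < 1 -> x < z -> N x < r.
  move=> /andP[x0 x1] xz.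
  have [y [->|[/andP[y0 y1] Ny]] xy] := sup_gt (ex_intro _ 0 S0) xz.
    by have := lt_trans x0 xy; rewrite ltxx.
  by apply: le_lt_trans Ny; apply: ndN => //; exact: ltW.
have Ngt x : 0 < x < 1 -> z < x -> r <= N x.
  move=> x01 zx; rewrite leNgt; apply/negP => Nx.
  have : x <= z by apply: (sup_upper_bound supS); right.
  by rewrite leNgt zx.
pose f x := expR (x * (w - t)) * x.
have ndf x y : 0 <= x -> x <= y -> f x <= f y.
  move=> x0 xy; apply: ler_pM => //; rewrite ?expR_ge0// ler_expR.
  by rewrite ler_wpM2r// subr_ge0.
have fz : 0 <= f z by rewrite mulr_ge0 ?expR_ge0.
have bf : bounded_measurable01 (fun x => expR (x * (w - t))).
  rewrite (_ : (fun _ => _) = fun x => expR (- (x * (t - w)))); first by bm01.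
  by apply/funext => x; congr expR; ring.
rewrite (tilt_shift w t).
(* Replacing the nondecreasing factor [f x] by [f z] can only lower the integral: [f x - f z] and
   [N x - r] have the same sign on each side of [z]. *)
apply: (@le_trans _ _ (f z * E w (fun x => (1 - x) * (N x - r)))).
  exact: mulr_ge0.
rewrite -[leLHS]addr0 -[X in _ + X](mul0r (E w (fun=> 0))) -tilt_lin//; [|by bm01..].
apply: le_tilt => //; [by bm01..|].
move=> x x01; have /andP[x0 x1] := x01; rewrite mul0r addr0.
rewrite -subr_ge0.
have -> : expR (x * (w - t)) * (x * ((1 - x) * (N x - r))) - f z * ((1 - x) * (N x - r))
  = (1 - x) * ((f x - f z) * (N x - r)) by rewrite /f; ring.
apply: mulr_ge0; first by rewrite subr_ge0 ltW.
have [xz|zx|->] := ltgtP x z; last by rewrite subrr mul0r.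
  apply: mulr_le0; rewrite subr_le0; first by apply: ndf; exact: ltW.
  by apply/ltW/Nlt.
apply: mulr_ge0; rewrite subr_ge0; first by apply: ndf => //; exact: ltW.
exact: Ngt.
Qed.

Lemma moment_recurrence0 w :
  s * (m w 0 - m w 1) - b * m w 1 + E w (fun x => (1 - x) * (x * g x)) =
  w * (m w 1 - m w 2).
Proof.
rewrite -(moment_recurrence w 0) addr0; congr (_ + _).
by apply: eq_tilt => x _; rewrite expr0 mul1r.
Qed.

Let bG : bounded_measurable01 (fun x => x * g x). Proof. by bm01. Qed.

Let b1G : bounded_measurable01 (fun x => (1 - x) * (x * g x)).
Proof. by bm01. Qed.

Lemma tilt_weighted_le (n : nat) (G : R -> R) (r t : R) : bounded_measurable01 G ->
  (forall x : R, 0 < x < 1 -> G x <= r) ->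
  E t (fun x => x ^+ n * ((1 - x) * G x)) <= r * (m t n - m t n.+1).
Proof.
move=> bGG Gr.
have -> : r * (m t n - m t n.+1) =
    E t (fun x => r * x ^+ n + (- r) * x ^+ n.+1).
  by rewrite tilt_lin//; [rewrite mulNr -mulrBr|by bm01..].
apply: le_tilt => //; [by bm01..|].
move=> x x01; have := Gr x x01; case/andP : x01 => x0 x1 Gx.
have -> : r * x ^+ n + - r * x ^+ n.+1 = x ^+ n * ((1 - x) * r).
  by rewrite exprS; ring.
apply: ler_wpM2l; first by rewrite exprn_ge0// ltW.
by apply: ler_wpM2l => //; rewrite subr_ge0 ltW.
Qed.

(** If w m_1 >= s m_0, the term w m_1^2 is at least s m_0 m_1, and [moment_bound] with [r = c]
    reduces the claim to 2 (s + 1 + c) <= b (p + s). Otherwise the recurrence at n = 0 expresses w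
    m_2, and the nonnegative correction helps. *)
Theorem moment_inequality_nonneg (p c w : R) : 0 <= w ->
  (forall x : R, 0 < x < 1 -> 0 <= x * g x <= c) -> 0 <= c ->
  2 * c <= p - s - 2 -> 2 * (s + 1 + c) <= b * (p + s) ->
  w * (2 * m w 2 * m w 0 - m w 1 ^+ 2) <= p * m w 0 * m w 1.
Proof.
move=> w0 Gc c0 cp bp.
have s0 := s_gt0; have b0 := b_gt0; have b1 := b_lt1.
have m0 := moment_ge0 w 0; have m1 := moment_ge0 w 1; have m2 := moment_ge0 w 2.
have m10 := moment_leS w 0.
have [wm|wm] := leP (s * m w 0) (w * m w 1).
  have s_ge0 := ltW s_gt0.
  have A0 : 0 <= s + 1 + c by rewrite !addr_ge0.
  have Ec t : 0 <= t <= w -> E t (fun x => x ^+ 1 * ((1 - x) * (x * g x))) <=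
      c * (m t 1 - m t 2).
    by move=> _; apply: tilt_weighted_le => // x /Gc /andP[].
  have := moment_bound c w w0 A0 Ec => H.
  rewrite -(ler_pM2l b_gt0).
  have h1 : b * w * m w 2 * m w 0 <= (s + 1 + c) * m w 1 * m w 0 by rewrite ler_wpM2r.
  have h2 : b * m w 1 * (s * m w 0) <= b * m w 1 * (w * m w 1).
    by rewrite ler_wpM2l// mulr_ge0// ltW.
  have h3 : 2 * (s + 1 + c) * (m w 0 * m w 1) <= b * (p + s) * (m w 0 * m w 1).
    by rewrite ler_wpM2r// mulr_ge0.
  lra.
have E0 : 0 <= E w (fun x => (1 - x) * (x * g x)).
  apply: tilt_ge0 => // x x01; have /andP[G0 _] := Gc x x01.
  by case/andP : x01 => x0 x1; rewrite mulr_ge0// subr_ge0 ltW.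
have rec := moment_recurrence0 w.
(* After substitution of the recurrence, the right side of the claim minus the left is the sum of
   the three nonnegative quantities in [h1], [h2] and [h3]. *)
have h1 : 0 <= (2 * m w 0 - m w 1) * (s * m w 0 - w * m w 1).
  by apply: mulr_ge0; lra.
have h2 : 0 <= (p - s - 2 * b) * (m w 0 * m w 1).
  by rewrite mulr_ge0 ?mulr_ge0//; lra.
have h3 : 0 <= 2 * m w 0 * E w (fun x => (1 - x) * (x * g x)) by rewrite !mulr_ge0.
have h4 : w * m w 2 * (2 * m w 0) = (w * m w 1 - (s * (m w 0 - m w 1) - b * m w 1 +
   E w (fun x => (1 - x) * (x * g x)))) * (2 * m w 0) by rewrite rec; ring.
lra.
Qed.

(** Here the correction in the n = 0 recurrence has the unfavourable sign. When w m_1 < s m_0, its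
    size [n0] is compared with [dl * m w 0], where dl = s - w m_1 / m_0. A small [n0] is absorbed by
    this deficit. A large one means that [- x * g x] averages more than [dl], which allows [A] to
    drop by [dl] in the bound on m_2. *)
Theorem moment_inequality_nonpos (p c w : R) : 0 <= w ->
  (forall x : R, 0 < x < 1 -> - c <= x * g x <= 0) -> 0 <= c ->
  (forall x y : R, 0 < x -> x <= y -> y < 1 -> y * g y <= x * g x) ->
  c <= p - s - 2 -> 2 * (s + 1) <= b * (p + s) -> 0 < m w 0 ->
  w * (2 * m w 2 * m w 0 - m w 1 ^+ 2) <= p * m w 0 * m w 1.
Proof.
move=> w0 Gc c0 niG cp bp m0.
have s0 := s_gt0; have b0 := b_gt0; have b1 := b_lt1.
have m0' := ltW m0.
have m1 := moment_ge0 w 1; have m2 := moment_ge0 w 2.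
have m10 := moment_leS w 0.
have [wm|wm] := leP (s * m w 0) (w * m w 1).
  have s_ge0 := ltW s_gt0.
  have A0 : 0 <= s + 1 + 0 by rewrite !addr_ge0.
  have Ec t : 0 <= t <= w -> E t (fun x => x ^+ 1 * ((1 - x) * (x * g x))) <=
      0 * (m t 1 - m t 2).
    by move=> _; apply: tilt_weighted_le => // x /Gc /andP[].
  have := moment_bound 0 w w0 A0 Ec => H.
  rewrite -(ler_pM2l b_gt0).
  have h1 : b * w * m w 2 * m w 0 <= (s + 1 + 0) * m w 1 * m w 0 by rewrite ler_wpM2r.
  have h2 : b * m w 1 * (s * m w 0) <= b * m w 1 * (w * m w 1).
    by rewrite ler_wpM2l// mulr_ge0// ltW.
  have h3 : 2 * (s + 1) * (m w 0 * m w 1) <= b * (p + s) * (m w 0 * m w 1).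
    by rewrite ler_wpM2r// mulr_ge0.
  lra.
set n0 := - E w (fun x => (1 - x) * (x * g x)).
pose dl := (s * m w 0 - w * m w 1) / m w 0.
have dlm : dl * m w 0 = s * m w 0 - w * m w 1 by rewrite divfK ?gt_eqF.
have dl0 : 0 < dl by rewrite divr_gt0// subr_gt0.
have rec := moment_recurrence0 w.
have [n0dl|dln0] := leP n0 (dl * m w 0).
  have n0c : n0 <= c * (m w 0 - m w 1).
    have -> : n0 = E w (fun x => x ^+ 0 * ((1 - x) * - (x * g x))).
      rewrite /n0 -[LHS]mulN1r -[LHS]addr0 -[X in _ + X](mul0r (E w (fun=> 0))).
      rewrite -tilt_lin//; [|by bm01..].
      by apply: eq_tilt => x _; ring.
    apply: tilt_weighted_le; first by bm01.
    by move=> x /Gc /andP[H _]; lra.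
  have h1 : w * m w 2 * (2 * m w 0) = (w * m w 1 - (s * (m w 0 - m w 1) - b * m w 1 -
   n0)) * (2 * m w 0) by rewrite -[X in _ + X]opprK in rec; rewrite rec; ring.
  have h2 : 0 <= (p - s - 2 - c) * (m w 0 * m w 1).
    by rewrite mulr_ge0 ?mulr_ge0//; lra.
  have h3 : 0 <= (2 - 2 * b) * (m w 0 * m w 1).
    by rewrite mulr_ge0 ?mulr_ge0//; lra.
  have h4 : w * m w 1 ^+ 2 = (s - dl) * m w 0 * m w 1.
    by rewrite mulrBl dlm; ring.
  have -> : w * (2 * m w 2 * m w 0 - m w 1 ^+ 2) = w * m w 2 * (2 * m w 0) - w * m w 1 ^+ 2.
    by ring.
  rewrite h1 h4 (_ : w * m w 1 = (s - dl) * m w 0); last by rewrite mulrBl dlm; ring.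
  (* What is left after [m w 0] is factored out and s + 2 - p <= -c and b < 1 are used. *)
  suff : 2 * (n0 - dl * m w 0) + (dl - c) * m w 1 <= 0.
    move=> /(ler_wpM2l m0'); rewrite mulr0; lra.
  have [dc|cd] := leP dl c.
    have : (dl - c) * m w 1 <= 0 by rewrite mulr_le0_ge0// subr_le0.
    lra.
  (* With [n0c], the terms in [m w 0] cancel and only a nonpositive multiple of [m w 1] remains. *)
  have : (dl - c) * m w 1 <= (dl - c) * (2 * m w 0).
    by rewrite ler_wpM2l ?subr_ge0 ?ltW//; lra.
  have : 0 <= c * m w 1 by rewrite mulr_ge0.
  lra.
have A0 : 0 <= s + 1 + (- dl).
  rewrite addrAC addr_ge0// subr_ge0 -(ler_pM2r m0) dlm.
  by rewrite gerBl mulr_ge0.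
(* A statement at [w] alone. Monotonicity of [x * g x] carries it to all [t <= w] and inserts the
   extra factor [x], as [moment_bound] requires. *)
have Edl : 0 <= E w (fun x => (1 - x) * (- (x * g x) - dl)).
  rewrite (@eq_tilt _ _ _ _ w _ (fun x => (-1) * ((1 - x) * (x * g x)) + 1 *
    ((- dl) * x ^+ 0 + dl * x ^+ 1))); last by move=> x _; rewrite expr0 expr1; ring.
  rewrite !tilt_lin//; try by bm01.
  rewrite -/(m w 0) -/(m w 1) mulN1r -/n0 mul1r.
  have : 0 <= dl * m w 1 by rewrite mulr_ge0// ltW.
  lra.
have Ec t : 0 <= t <= w -> E t (fun x => x ^+ 1 * ((1 - x) * (x * g x))) <=
    (- dl) * (m t 1 - m t 2).
  move=> /andP[_ tw].
  have ndN x y : 0 < x -> x <= y -> y < 1 -> - (x * g x) <= - (y * g y).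
    by move=> x0 xy y1; rewrite lerN2 niG.
  have bN : bounded_measurable01 (fun x => - (x * g x)) by bm01.
  have := tilt_ge_monotone (fun x => - (x * g x)) dl w t bN ndN tw Edl.
  rewrite (@eq_tilt _ _ _ _ t _ (fun x => (-1) * (x ^+ 1 * ((1 - x) * (x * g x))) + 1 *
    ((- dl) * x ^+ 1 + dl * x ^+ 2))); last by move=> x _; ring.
  rewrite !tilt_lin//; try by bm01.
  rewrite -/(m t 1) -/(m t 2); lra.
have H := moment_bound (- dl) w w0 A0 Ec.
rewrite -(ler_pM2l b_gt0).
have h1 : b * w * m w 2 * m w 0 <= (s + 1 - dl) * m w 1 * m w 0 by rewrite ler_wpM2r.
have h2 : b * (w * m w 1 ^+ 2) = b * (s - dl) * m w 0 * m w 1.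
  rewrite -!mulrA; congr (b * _); rewrite mulrA mulrBl dlm; ring.
have h3 : 2 * (s + 1) * (m w 0 * m w 1) <= b * (p + s) * (m w 0 * m w 1).
  by rewrite ler_wpM2r// mulr_ge0.
(* Compared with the case w m_1 >= s m_0, [A] loses [dl], which counts twice, while w m_1 loses
   [dl * m w 0], which counts [b] times; the balance is favourable. *)
have h4 : 0 <= (2 - b) * dl * (m w 0 * m w 1).
  by apply: mulr_ge0; [apply: mulr_ge0; [lra|exact: ltW]|exact: mulr_ge0].
lra.
Qed.

End moment_inequality.

(** * Normal integrals and the Stein identity *)

Section normal.
Context {R : realType}.
Notation mu := (@lebesgue_measure R).
Implicit Types (m s x : R).

(** Changes of variables go through the Radon-Nikodym derivative; it has the same integral as the
    explicit density over every measurable set, so the two agree almost everywhere. *)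
Let RN_normal_pdf m s : ae_eq mu setT
  (Radon_Nikodym_SigmaFinite.f (@normal_prob R m s) mu)
  (fun x => (normal_pdf m s x)%:E).
Proof.
have dom := @normal_prob_dominates R m s.
apply: integral_ae_eq => //.
- exact: Radon_Nikodym_SigmaFinite.f_integrable.
- by apply/measurable_EFinP; exact: measurable_normal_pdf.
- by move=> E _ mE; rewrite -Radon_Nikodym_SigmaFinite.f_integral.
Qed.

Lemma ge0_integral_normal_prob m s (f : R -> \bar R) :
  measurable_fun setT f -> (forall x, 0 <= f x)%E ->
  (\int[normal_prob m s]_x f x = \int[mu]_x (f x * (normal_pdf m s x)%:E))%E.
Proof.
move=> mf f0; have dom := @normal_prob_dominates R m s.
rewrite -(@Radon_Nikodym_SigmaFinite.change_of_variables _ _ _ _ mu dom)//.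
apply: ae_eq_integral => //.
- apply: emeasurable_funM => //.
  by have /measurable_int :=
    @Radon_Nikodym_SigmaFinite.f_integrable _ _ _ (@normal_prob R m s) mu dom.
- apply: emeasurable_funM => //.
  by apply/measurable_EFinP; exact: measurable_normal_pdf.
- by apply: ae_eqe_mul2l; exact: RN_normal_pdf.
Qed.

Lemma integrable_normal_prob m s (f : R -> R) :
  measurable_fun setT f ->
  mu.-integrable setT (EFin \o (fun x => f x * normal_pdf m s x)) ->
  (@normal_prob R m s).-integrable setT (EFin \o f).
Proof.
move=> mf /integrableP[_ intf]; apply/integrableP; split; first exact/measurable_EFinP.
rewrite ge0_integral_normal_prob//; last first.
  by apply/measurable_EFinP; exact: measurableT_comp.
under eq_integral do rewrite /= -EFinM -(ger0_norm (normal_pdf_ge0 m s _)) -normrM.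
exact: intf.
Qed.

Lemma integral_normal_prob m s (f : R -> R) :
  measurable_fun setT f ->
  mu.-integrable setT (EFin \o (fun x => f x * normal_pdf m s x)) ->
  (\int[normal_prob m s]_x (f x)%:E = \int[mu]_x (f x * normal_pdf m s x)%:E)%E.
Proof.
move=> mf intf; have := integrable_normal_prob m s f mf intf => nf.
have dom := @normal_prob_dominates R m s.
rewrite [LHS]integralE [RHS]integralE.
rewrite !ge0_integral_normal_prob//; last 2 first.
- by apply: measurable_funeneg; exact/measurable_EFinP.
- by apply: measurable_funepos; exact/measurable_EFinP.
congr (_ - _)%E; apply: eq_integral => x _.
- rewrite !funeposE /= -!EFin_max -EFinM; congr EFin.
  by rewrite maxr_pMl ?normal_pdf_ge0// mul0r.
- rewrite !funenegE /= -!EFin_max -EFinM; congr EFin.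
  by rewrite maxr_pMl ?normal_pdf_ge0// mul0r mulNr.
Qed.

(** Put u = (x - m)^2. Doubling the standard deviation frees a factor exp(-cu) with c = (1/2 - 1/8)
    / s^2, and 1 + u <= (1 + 1/c) (1 + cu) <= (1 + 1/c) exp(cu). *)
Lemma normal_pdf_sqr_le m s : 0 < s -> exists2 C : R, 0 < C & forall x,
  (1 + (x - m) ^+ 2) * normal_pdf m s x <= C * normal_pdf m (2 * s) x.
Proof.
move=> s0; have s20 : 0 < 2 * s by rewrite mulr_gt0.
pose c := 3 / (8 * s ^+ 2); have c0 : 0 < c by rewrite divr_gt0// mulr_gt0// exprn_gt0.
have p0 : 0 < normal_peak (2 * s) by rewrite normal_peak_gt0 ?gt_eqF.
have p1 : 0 < normal_peak s by rewrite normal_peak_gt0 ?gt_eqF.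
exists ((1 + c^-1) * normal_peak s / normal_peak (2 * s)).
  by rewrite divr_gt0// mulr_gt0// addr_gt0// invr_gt0.
move=> x; rewrite !normal_pdfE ?gt_eqF//.
rewrite [leRHS](_ : _ = normal_peak s * ((1 + c^-1) * normal_fun m (2 * s) x)); last first.
  by move: (c^-1) => k; field; rewrite gt_eqF.
rewrite mulrCA ler_pM2l// /normal_fun.
set u := (x - m) ^+ 2; have u0 : 0 <= u by rewrite sqr_ge0.
have -> : - u / (s ^+ 2 *+ 2) = - (c * u) + - u / ((2 * s) ^+ 2 *+ 2).
  by rewrite /c; field; rewrite gt_eqF.
rewrite expRD mulrA ler_pM2r ?expR_gt0// expRN ler_pdivrMr ?expR_gt0//.
apply: (@le_trans _ _ ((1 + c^-1) * (1 + c * u))).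
  rewrite (_ : (1 + c^-1) * _ = 1 + u + (c * u + c^-1)); last first.
    by move: c0; generalize c => k k0; field; rewrite gt_eqF.
  have cge0 := ltW c0; by rewrite lerDl addr_ge0// ?invr_ge0// mulr_ge0.
by rewrite ler_wpM2l ?expR_ge1Dx// addr_ge0// invr_ge0 (ltW c0).
Qed.

Lemma integrable_sqr_normal_pdf m s (f : R -> R) (C : R) : 0 < s ->
  measurable_fun setT f -> (forall x, `|f x| <= C * (1 + (x - m) ^+ 2)) ->
  mu.-integrable setT (EFin \o (fun x => f x * normal_pdf m s x)).
Proof.
move=> s0 mf fC; have [K K0 HK] := normal_pdf_sqr_le m s s0.
have ig : mu.-integrable setT (fun x => (`|C| * K)%:E * (normal_pdf m (2 * s) x)%:E)%E.
  by apply: integrableZl => //; exact: integrable_normal_pdf.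
apply: le_integrable ig => //.
  by apply/measurable_EFinP; apply: measurable_funM => //; exact: measurable_normal_pdf.
move=> x _; rewrite lee_fin !normrM normr_id (ger0_norm (normal_pdf_ge0 _ _ _)).
rewrite (ger0_norm (ltW K0)) (ger0_norm (normal_pdf_ge0 _ _ _)).
apply: (@le_trans _ _ (`|C| * (1 + (x - m) ^+ 2) * normal_pdf m s x)).
  rewrite ler_wpM2r ?normal_pdf_ge0// (le_trans (fC x))// ler_wpM2r ?ler_norm//.
  by rewrite addr_ge0// sqr_ge0.
by rewrite -!mulrA ler_wpM2l.
Qed.

Lemma is_derive_normal_pdf m s x : 0 < s ->
  is_derive x 1 (normal_pdf m s) (- ((x - m) / s ^+ 2) * normal_pdf m s x).
Proof.
move=> s0; rewrite normal_pdfE ?gt_eqF//.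
have d0 : is_derive x 1 (fun x => x - m) 1.
  by rewrite -[X in is_derive _ _ _ X]subr0; apply: is_deriveB.
pose k := - (s ^+ 2 *+ 2)^-1.
have d1 : is_derive x 1 (fun x => - (x - m) ^+ 2 / (s ^+ 2 *+ 2)) (- ((x - m) / s ^+ 2)).
  have := @is_deriveZ _ _ _ _ k _ _ _ (@is_deriveX _ _ _ 2 _ _ _ d0).
  rewrite exprfctE /GRing.scale/= mulr1 expr1 => d.
  rewrite (_ : (fun _ => _) = fun x => k * (x - m) ^+ 2).
    by apply: (is_derive_eq d); rewrite /k; field; rewrite gt_eqF.
  by apply/funext => y; rewrite /k; field; rewrite gt_eqF.
have d2 := @is_derive1_comp _ expR _ x _ _ (is_derive_expR _) d1.
have := @is_deriveZ _ _ _ _ (normal_peak s) _ _ _ d2.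
rewrite /GRing.scale/= => d; apply: (is_derive_eq d).
by rewrite /normal_fun; ring.
Qed.

(** Used at the points m + (n + 1) and m - (n + 1), to remove the boundary terms of the Stein
    identity. *)
Lemma cvg_normal_pdf_sqr m s (x_ : nat -> R) : 0 < s ->
  (forall n, (x_ n - m) ^+ 2 = n.+1%:R ^+ 2) ->
  (1 + (x_ n - m) ^+ 2) * normal_pdf m s (x_ n) @[n --> \oo] --> (0 : R).
Proof.
move=> s0 xE; have [K K0 HK] := normal_pdf_sqr_le m s s0.
have s20 : 0 < 2 * s by rewrite mulr_gt0.
pose c := 2 * (2 * s) ^+ 2; have c0 : 0 < c by rewrite mulr_gt0// exprn_gt0.
pose L := K * (normal_peak (2 * s) * c).
apply: (@squeeze_cvgr _ _ _ _ (cst 0) (fun n => L * harmonic n)).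
- apply: nearW => n; apply/andP; split.
    by rewrite mulr_ge0 ?normal_pdf_ge0// addr_ge0// sqr_ge0.
  apply: (le_trans (HK _)); rewrite /L -[leRHS]mulrA ler_pM2l//.
  rewrite normal_pdfE ?gt_eqF// -[leRHS]mulrA ler_wpM2l ?normal_peak_ge0//.
  rewrite /normal_fun xE mulNr expRN.
  rewrite invf_ple ?posrE ?expR_gt0//; last first.
    by rewrite mulr_gt0// /harmonic/= invr_gt0.
  rewrite /harmonic/= invfM invrK.
  apply: le_trans (expR_ge1Dx _).
  rewrite (_ : _ / (_ *+ 2) = c^-1 * n.+1%:R ^+ 2); last first.
    by rewrite mulrC; congr (_^-1 * _); rewrite /c [RHS]mulr_natl.
  apply: (@le_trans _ _ (c^-1 * n.+1%:R ^+ 2)); last by rewrite lerDr.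
  rewrite ler_pM2l ?invr_gt0// expr2 ler_peMl//.
  by rewrite ler1n.
- exact: cvg_cst.
- by rewrite -(mulr0 L); apply: cvgM; [exact: cvg_cst|exact: cvg_harmonic].
Qed.

(** The density q satisfies s^2 q' = -(x - m) q, so the integrand is the derivative of s^2 F q.
    Quadratic growth gives integrability and makes the boundary terms vanish. *)
Lemma stein_lebesgue m s (F dF : R -> R) (C : R) : 0 < s ->
  (forall x, is_derive x 1 F (dF x)) -> continuous dF ->
  (forall x, `|F x| <= C * (1 + (x - m) ^+ 2)) ->
  (forall x, `|F x * (x - m)| <= C * (1 + (x - m) ^+ 2)) ->
  (forall x, `|dF x| <= C * (1 + (x - m) ^+ 2)) ->
  \int[mu]_x ((s ^+ 2 * dF x - F x * (x - m)) * normal_pdf m s x) = 0.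
Proof.
move=> s0 dFx cdF FC FxC dFC.
have cF : continuous F.
  by move=> x; apply/differentiable_continuous/derivable1_diffP; have [] := dFx x.
pose f x := s ^+ 2 * dF x - F x * (x - m).
have cf : continuous f.
  move=> x; apply: cvgB; apply: cvgM; [exact: cvg_cst|exact: cdF|exact: cF|].
  by apply: cvgB; [exact: cvg_id|exact: cvg_cst].
have mf : measurable_fun setT f by exact: continuous_measurable_fun.
have fC x : `|f x| <= (s ^+ 2 * C + C) * (1 + (x - m) ^+ 2).
  rewrite (le_trans (ler_normB _ _))// mulrDl lerD// normrM -mulrA.
  by rewrite ger0_norm ?sqr_ge0// ler_wpM2l// sqr_ge0.
have intf := integrable_sqr_normal_pdf m s f _ s0 mf fC.
pose G x := s ^+ 2 * (F x * normal_pdf m s x).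
have dG x : setT x -> is_derive x 1 G (f x * normal_pdf m s x).
  move=> _; have := @is_deriveZ _ _ _ _ (s ^+ 2) _ _ _
    (@is_deriveM _ _ _ _ _ _ _ _ (dFx x) (is_derive_normal_pdf m s x s0)).
  rewrite /GRing.scale/= => d; apply: (is_derive_eq d).
  by rewrite /f; field; rewrite gt_eqF.
have cfp x : setT x -> {for x, continuous (fun x => f x * normal_pdf m s x)}.
  by move=> _; apply: cvgM; [exact: cf|apply: continuous_normal_pdf; rewrite gt_eqF].
pose a_ n := m - n.+1%:R; pose b_ n := m + n.+1%:R.
have G0 (x_ : nat -> R) : (forall n, (x_ n - m) ^+ 2 = n.+1%:R ^+ 2) ->
    G (x_ n) @[n --> \oo] --> (0 : R).
  move=> xE; apply: norm_cvg0.
  apply: (@squeeze_cvgr _ _ _ _ (cst 0)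
    (fun n => s ^+ 2 * C * ((1 + (x_ n - m) ^+ 2) * normal_pdf m s (x_ n)))).
  - apply: nearW => n; rewrite normr_ge0/= /G normrM.
    rewrite (ger0_norm (sqr_ge0 s)) normrM (ger0_norm (normal_pdf_ge0 _ _ _)).
    by rewrite -mulrA ler_wpM2l ?sqr_ge0// mulrA ler_wpM2r ?normal_pdf_ge0.
  - exact: cvg_cst.
  - rewrite -(mulr0 (s ^+ 2 * C)); apply: cvgM; first exact: cvg_cst.
    exact: cvg_normal_pdf_sqr.
apply: (@integral_exhaustion _ setT _ G a_ b_ _ _ _ _ _ _ dG _ intf) => //.
- by move=> n; rewrite /a_ /b_ ltrD2l gtrN.
- move=> x _; near=> n; rewrite /a_ /b_ -ler_distl.
  have : `|x - m| <= n%:R by near: n; exact: nbhs_infty_ger.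
  by move=> /le_trans; apply; rewrite ler_nat.
- by have /measurable_int/measurable_EFinP := intf.
- rewrite -[X in _ --> X](subrr 0); apply: cvgB; apply: G0 => n.
    by rewrite /b_ addrC addKr.
  by rewrite /a_ addrC addKr sqrrN.
Unshelve. all: by end_near. Qed.

End normal.

(** * Iterated integrals and the Stein identity for the multivariate normal law *)

Section mvnormal_integral.
Context {R : realType}.
Implicit Types (n : nat).

Definition tcons n (u : R) (v : n.-tuple R) : n.+1.-tuple R :=
  [tuple of u :: v].

Lemma measurable_tcons n :
  measurable_fun setT (fun w : measurableTypeR R * n.-tuple R => tcons n w.1 w.2).
Proof. exact: (@measurable_cons_pair R n). Qed.

Lemma ge0_integral_mvnormalS n (beta : n.+1.-tuple R) (f : n.+1.-tuple R -> \bar R) :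
  measurable_fun setT f -> (forall y, 0 <= f y)%E ->
  (\int[mvnormal beta]_y f y =
   \int[normal_prob (thead beta) 1]_u
     \int[mvnormal (behead_tuple beta)]_v f (tcons n u v))%E.
Proof.
move=> mf f0; rewrite /= /prod_cons ge0_integral_distribution//.
rewrite fubini_tonelli1//=.
exact: (measurableT_comp mf (measurable_tcons n)).
Qed.

Lemma integrable_mvnormalS n (beta : n.+1.-tuple R) (f : n.+1.-tuple R -> R) :
  (mvnormal beta).-integrable setT (EFin \o f) ->
  ((normal_prob (thead beta) 1) \x (mvnormal (behead_tuple beta)))%E.-integrable
    setT (fun w : measurableTypeR R * n.-tuple R => (f (tcons n w.1 w.2))%:E).
Proof.
move=> /integrableP[mf intf]; apply/integrableP; split.
  exact: (measurableT_comp mf (measurable_tcons n)).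
move: intf; rewrite /= /prod_cons ge0_integral_distribution//.
by apply/measurable_EFinP; apply: measurableT_comp => //; exact/measurable_EFinP.
Qed.

(** Both orders are needed: the Stein identity wants the coordinate of differentiation, head or
    tail, in the inner integral. *)
Lemma integral_mvnormalS n (beta : n.+1.-tuple R) (f : n.+1.-tuple R -> R) :
  (mvnormal beta).-integrable setT (EFin \o f) ->
  (\int[mvnormal beta]_y (f y)%:E =
   \int[normal_prob (thead beta) 1]_u
     \int[mvnormal (behead_tuple beta)]_v (f (tcons n u v))%:E)%E /\
  (\int[mvnormal beta]_y (f y)%:E =
   \int[mvnormal (behead_tuple beta)]_v
     \int[normal_prob (thead beta) 1]_u (f (tcons n u v))%:E)%E.
Proof.
move=> intf; have ip := integrable_mvnormalS n beta f intf.
have E : (\int[mvnormal beta]_y (f y)%:E =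
  \int[normal_prob (thead beta) 1 \x mvnormal (behead_tuple beta)]_w
     (f (tcons n w.1 w.2))%:E)%E.
  rewrite /= /prod_cons (integral_distribution _ ip)//.
  exact: measurable_int intf.
by split; rewrite E; [rewrite -integral12_prod_meas1|rewrite -integral21_prod_meas1].
Qed.

Lemma sqnorm_ge0 n (y : n.-tuple R) : 0 <= sqnorm y.
Proof. by apply: sumr_ge0 => i _; exact: sqr_ge0. Qed.

Lemma sqnorm_cons n (u : R) (v : n.-tuple R) :
  sqnorm (tcons n u v) = u ^+ 2 + sqnorm v.
Proof.
rewrite /sqnorm big_ord_recl; congr (_ + _).
by apply: eq_bigr => i _; rewrite tnthS.
Qed.

Lemma measurable_sqnorm n : measurable_fun setT (@sqnorm R n).
Proof.
apply: measurable_sum => i; apply: measurable_funX; exact: measurable_tnth.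
Qed.

(** Only finiteness matters: [1 + sqnorm] dominates every integrand of quadratic growth. *)
Lemma integral_sqnorm_mvnormal n (beta : n.-tuple R) : exists2 C : R, 0 <= C &
  (\int[mvnormal beta]_y (1 + sqnorm y)%:E = C%:E)%E.
Proof.
have q0 k (y : k.-tuple R) : (0 <= (1 + sqnorm y)%:E)%E.
  by rewrite lee_fin addr_ge0// sqnorm_ge0.
have mq k : measurable_fun setT (fun y : k.-tuple R => (1 + sqnorm y)%:E).
  by apply/measurable_EFinP; apply: measurable_funD => //; exact: measurable_sqnorm.
elim: n beta => [beta|n IH beta].
  exists 1 => //.
  rewrite (eq_integral (cst 1%:E)); last first.
    by move=> y _; rewrite /sqnorm big_ord0 addr0.
  by rewrite integral_cst// mul1e; apply: probability_setT.
have [C C0 CE] := IH (behead_tuple beta).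
rewrite ge0_integral_mvnormalS//; set m := thead beta.
pose f u : R := u ^+ 2 + C.
have mf : measurable_fun setT f by apply: measurable_funD.
have fb u : `|f u| <= (2 + 2 * m ^+ 2 + C) * (1 + (u - m) ^+ 2).
  rewrite ger0_norm ?addr_ge0 ?sqr_ge0// /f.
  have : 0 <= m ^+ 2 by exact: sqr_ge0.
  have : 0 <= (u - m) ^+ 2 by exact: sqr_ge0.
  have : 0 <= (u - 2 * m) ^+ 2 by exact: sqr_ge0.
  by nra.
have ipdf := integrable_sqr_normal_pdf m 1 f _ ltr01 mf fb.
have inf := integrable_normal_prob m 1 f mf ipdf.
have fin : (\int[normal_prob m 1]_u (f u)%:E)%E \is a fin_num.
  exact: integrable_fin_num inf.
exists (fine (\int[normal_prob m 1]_u (f u)%:E)%E).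
  by apply: fine_ge0; apply: integral_ge0 => u _; rewrite lee_fin addr_ge0// sqr_ge0.
rewrite fineK//; apply: eq_integral => u _.
under eq_integral do rewrite sqnorm_cons addrCA EFinD.
rewrite ge0_integralD//; [|by move=> v _; rewrite lee_fin sqr_ge0|exact: mq].
rewrite CE integral_cst// /f EFinD; congr (_ + _)%E.
by rewrite [X in (_ * X)%E]probability_setT mule1.
Qed.

Lemma integrable_mvnormal n (beta : n.-tuple R) (f : n.-tuple R -> R) (C : R) :
  measurable_fun setT f -> (forall y, `|f y| <= C * (1 + sqnorm y)) ->
  (mvnormal beta).-integrable setT (EFin \o f).
Proof.
move=> mf fC; have [K K0 KE] := integral_sqnorm_mvnormal n beta.
have iq : (mvnormal beta).-integrable setT (fun y => C%:E * (1 + sqnorm y)%:E)%E.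
  apply: integrableZl => //; apply/integrableP; split.
    by apply/measurable_EFinP; apply: measurable_funD => //; exact: measurable_sqnorm.
  under eq_integral do rewrite gee0_abs ?lee_fin ?addr_ge0 ?sqnorm_ge0//.
  by rewrite KE ltry.
apply: le_integrable iq => //; first exact/measurable_EFinP.
move=> y _; rewrite lee_fin (le_trans (fC y))// ler_norm.
by [].
Qed.

Definition update n (y : n.-tuple R) (i : 'I_n) (x : R) : n.-tuple R :=
  [tuple if j == i then x else tnth y j | j < n].

Lemma update0 n (u : R) (v : n.-tuple R) x :
  update n.+1 (tcons n u v) ord0 x = tcons n x v.
Proof.
apply: eq_from_tnth => j; rewrite tnth_mktuple.
by case: (unliftP ord0 j) => [k|] ->; rewrite ?eqxx// tnthS tnthS.
Qed.

Lemma update_lift n (u : R) (v : n.-tuple R) i x :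
  update n.+1 (tcons n u v) (lift ord0 i) x = tcons n u (update n v i x).
Proof.
apply: eq_from_tnth => j; rewrite tnth_mktuple.
case: (unliftP ord0 j) => [k|] -> //.
by rewrite tnthS tnthS tnth_mktuple (inj_eq (@lift_inj _ ord0)).
Qed.

(** Induction on the dimension. With the head [u] fixed, the tail inherits the growth bounds with
    constant [C * (1 + u ^+ 2)]; with the tail fixed, the identity on the line applies. *)
Lemma stein_mvnormal n (beta : n.-tuple R) (i : 'I_n) (F D : n.-tuple R -> R) (C : R) :
  measurable_fun setT F -> measurable_fun setT D ->
  (forall y (x : R), is_derive x 1 (fun x => F (update n y i x)) (D (update n y i x))) ->
  (forall y, continuous (fun x => D (update n y i x))) ->
  (forall y, `|F y| <= C * (1 + sqnorm y)) ->
  (forall y, `|F y * (tnth y i - tnth beta i)| <= C * (1 + sqnorm y)) ->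
  (forall y, `|D y| <= C * (1 + sqnorm y)) ->
  (\int[mvnormal beta]_y (D y - F y * (tnth y i - tnth beta i))%:E = 0)%E.
Proof.
elim: n beta i F D C => [beta []//|n IH beta i F D C mF mD dF cD FC FxC DC].
have C0 : 0 <= C.
  have := le_trans (normr_ge0 _) (FC beta).
  by rewrite pmulr_lge0// ltr_pwDl// sqnorm_ge0.
pose f y := D y - F y * (tnth y i - tnth beta i).
have mf : measurable_fun setT f.
  apply: measurable_funB => //; apply: measurable_funM => //.
  by apply: measurable_funB => //; exact: measurable_tnth.
have fC y : `|f y| <= (C + C) * (1 + sqnorm y).
  by rewrite mulrDl (le_trans (ler_normB _ _))// lerD.
have [E1 E2] := integral_mvnormalS n beta f (integrable_mvnormal n.+1 beta f _ mf fC).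
case: (unliftP ord0 i) => [j|] iE; rewrite {}iE in f mf fC E1 E2 dF cD FxC *.
  rewrite -[LHS]/(\int[mvnormal beta]_y (f y)%:E)%E E1.
  apply: integral0_eq => u _.
  have mcu : measurable_fun setT (tcons n u).
    by apply: measurable_cons => //; exact: measurable_cst.
  rewrite /f; under eq_integral do rewrite [in tnth beta _](tuple_eta beta) !tnthS.
  have le_u (v : n.-tuple R) : C * (1 + sqnorm (tcons n u v)) <= C * (1 + u ^+ 2) * (1 + sqnorm v).
    rewrite -mulrA ler_wpM2l// sqnorm_cons.
    have := sqnorm_ge0 n v; have := sqr_ge0 u; nra.
  apply: (IH (behead_tuple beta) j (F \o tcons n u) (D \o tcons n u)
     (C * (1 + u ^+ 2))).
  - exact: measurableT_comp.
  - exact: measurableT_comp.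
  - by move=> v x /=; have := dF (tcons n u v) x; rewrite !update_lift;
      under eq_fun do rewrite update_lift.
  - by move=> v /=; have := cD (tcons n u v);
      under eq_fun do rewrite update_lift.
  - by move=> v /=; rewrite (le_trans (FC _)).
  - move=> v /=; rewrite (le_trans _ (le_u v))//.
    by have := FxC (tcons n u v); rewrite [in tnth beta _](tuple_eta beta) !tnthS.
  - by move=> v /=; rewrite (le_trans (DC _)).
rewrite -[LHS]/(\int[mvnormal beta]_y (f y)%:E)%E E2.
apply: integral0_eq => v _; set m := thead beta.
have mcv : measurable_fun setT (fun u => f (tcons n u v)).
  apply: measurableT_comp mf _.
  by apply: measurable_cons => //; exact: measurable_cst.
pose C' := C * (2 + 2 * m ^+ 2) * (1 + sqnorm v).
have le_v (u : R) : C * (1 + sqnorm (tcons n u v)) <= C' * (1 + (u - m) ^+ 2).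
  rewrite /C' -!mulrA ler_wpM2l// sqnorm_cons.
  have h1 := sqnorm_ge0 n v.
  have h2 : 0 <= m ^+ 2 by exact: sqr_ge0.
  have h3 : 0 <= (u - m) ^+ 2 by exact: sqr_ge0.
  (* Equivalent to u^2 <= 2 m^2 + 2 (u - m)^2, which recentres the growth bound at the mean. *)
  have h4 : 0 <= (u - 2 * m) ^+ 2 by exact: sqr_ge0.
  have h5 : 1 + u ^+ 2 <= (2 + 2 * m ^+ 2) * (1 + (u - m) ^+ 2) by nra.
  have h6 : 1 <= (2 + 2 * m ^+ 2) * (1 + (u - m) ^+ 2) by nra.
  have h7 : (1 + u ^+ 2) + sqnorm v <= (2 + 2 * m ^+ 2) * (1 + (u - m) ^+ 2) * (1 + sqnorm v).
    by nra.
  by nra.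
have fb u : `|f (tcons n u v)| <= (C' + C') * (1 + (u - m) ^+ 2).
  by rewrite (le_trans (fC _))// mulrDl [leRHS]mulrDl lerD.
have ipdf := integrable_sqr_normal_pdf m 1 _ _ ltr01 mcv fb.
rewrite integral_normal_prob//.
have st := stein_lebesgue m 1 (fun u => F (tcons n u v)) (fun u => D (tcons n u v)) C' ltr01.
rewrite -[LHS]fineK; last exact: integrable_fin_num ipdf.
rewrite -[X in X%:E]/(\int[lebesgue_measure]_u (f (tcons n u v) * normal_pdf m 1 u)).
congr EFin; rewrite -[RHS]st.
- by apply: eq_Rintegral => u _; rewrite /f expr1n mul1r.
- by move=> x; have := dF (tcons n 0 v) x; rewrite !update0;
      under eq_fun do rewrite update0.
- by have := cD (tcons n 0 v); under eq_fun do rewrite update0.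
- by move=> u; rewrite (le_trans (FC _)).
- by move=> u; rewrite (le_trans _ (le_v u))//; exact: FxC (tcons n u v).
- by move=> u; rewrite (le_trans (DC _)).
Qed.

End mvnormal_integral.

(** * The minimax value *)

Section tonelli.
Context {R : realType}.
Local Open Scope ereal_scope.

Section two.
Context d1 d2 (T1 : measurableType d1) (T2 : measurableType d2).
Variables (m1 : probability T1 R) (m2 : probability T2 R).
Variable f : T1 -> T2 -> \bar R.
Hypothesis mf : measurable_fun setT (fun w : T1 * T2 => f w.1 w.2).
Hypothesis f0 : forall x y, 0 <= f x y.

Lemma measurable_partial_integral :
  measurable_fun setT (fun x => \int[m2]_y f x y).
Proof.
exact: (@measurable_fun_fubini_tonelli_F _ _ _ _ _ m2 _ mf (fun w => f0 w.1 w.2)).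
Qed.

Lemma tonelli_prod :
  \int[m1]_x \int[m2]_y f x y = \int[(m1 \x m2)]_w f w.1 w.2.
Proof. by rewrite (fubini_tonelli1 _ mf (fun w => f0 w.1 w.2)). Qed.

Lemma tonelli_swap :
  \int[m1]_x \int[m2]_y f x y = \int[m2]_y \int[m1]_x f x y.
Proof. exact: (@fubini_tonelli _ _ _ _ _ m1 m2 _ mf (fun w => f0 w.1 w.2)). Qed.

End two.

Section four.
Context dA dB dC dD (A : measurableType dA) (B : measurableType dB)
  (C : measurableType dC) (D : measurableType dD).
Variables (mA : probability A R) (mB : probability B R)
  (mC : probability C R) (mD : probability D R).
Variable F : A -> B -> C -> D -> \bar R.
Hypothesis mF : measurable_fun setT
  (fun w : (A * B) * (C * D) => F w.1.1 w.1.2 w.2.1 w.2.2).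
Hypothesis F0 : forall a b c d, 0 <= F a b c d.

Lemma measurable_comp4 d (T : measurableType d)
    (a : T -> A) (b : T -> B) (c : T -> C) (e : T -> D) :
  measurable_fun setT a -> measurable_fun setT b ->
  measurable_fun setT c -> measurable_fun setT e ->
  measurable_fun setT (fun t => F (a t) (b t) (c t) (e t)).
Proof.
move=> ma mb mc me.
apply: (measurableT_comp mF (g := fun t => ((a t, b t), (c t, e t)))).
by apply: measurable_fun_pair; exact: measurable_fun_pair.
Qed.

Lemma tonelli4_inner :
  \int[mA]_a \int[mB]_b \int[mC]_c \int[mD]_e F a b c e =
  \int[mA]_a \int[mC]_c \int[mB]_b \int[mD]_e F a b c e.
Proof.
apply: eq_integral => a _; apply: tonelli_swap.
  apply: (@measurable_partial_integral _ _ _ _ mD (fun w => F a w.1 w.2)) => //.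
  by apply: measurable_comp4 => //; exact: measurableT_comp.
by move=> b c; exact: integral_ge0.
Qed.

Lemma measurable_regroup : measurable_fun setT
  (fun w : (A * C) * (B * D) => F w.1.1 w.2.1 w.1.2 w.2.2).
Proof. by apply: measurable_comp4; apply: measurableT_comp. Qed.

(** From (head, tail) of the parameter followed by (head, tail) of the observation, to the two pairs
    (parameter, observation). *)
Lemma tonelli4 :
  \int[mA]_a \int[mB]_b \int[mC]_c \int[mD]_e F a b c e =
  \int[(mA \x mC)]_w \int[(mB \x mD)]_x F w.1 x.1 w.2 x.2.
Proof.
rewrite tonelli4_inner.
have E1 a c : \int[mB]_b \int[mD]_e F a b c e =
    \int[(mB \x mD)]_w F a w.1 c w.2.
  by apply: tonelli_prod => //; exact: measurable_comp4.
under eq_integral do under eq_integral do rewrite E1.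
rewrite (tonelli_prod _ _ _ _ mA mC (fun a c => \int[(mB \x mD)]_w F a w.1 c w.2))//.
- apply: (@measurable_partial_integral _ _ _ _ (mB \x mD)%E
    (fun w x => F w.1 x.1 w.2 x.2)) => //; exact: measurable_regroup.
- by move=> a c; exact: integral_ge0.
Qed.

End four.
End tonelli.

(** * Normal laws relative to the standard one *)

Section likelihood.
Context {R : realType}.
Implicit Types (n : nat).
Notation gauss := (@normal_prob R 0 1 : probability (measurableTypeR R) R).

Definition zero_tuple n : n.-tuple R := nseq_tuple n 0.
Definition std_mvnormal n := mvnormal (zero_tuple n).

Lemma ge0_integral_std_mvnormalS n (f : n.+1.-tuple R -> \bar R) :
  measurable_fun setT f -> (forall y, 0 <= f y)%E ->
  (\int[std_mvnormal n.+1]_y f y =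
   \int[gauss]_u \int[std_mvnormal n]_v f (tcons n u v))%E.
Proof.
move=> mf f0; rewrite /std_mvnormal.
have : thead (zero_tuple n.+1) = 0 by [].
have : behead_tuple (zero_tuple n.+1) = zero_tuple n by exact: val_inj.
move: (zero_tuple n.+1) (zero_tuple n) => z z' z1 z2.
by rewrite (ge0_integral_mvnormalS n z f mf f0) z1 z2.
Qed.

(** The Radon-Nikodym derivative of N(t, 1) with respect to N(0, 1). *)
Definition likelihood1 (t x : R) : R := expR (t * x - t ^+ 2 / 2).

Definition likelihood n (beta y : n.-tuple R) : R :=
  expR (\sum_(i < n) (tnth beta i * tnth y i - tnth beta i ^+ 2 / 2)).

Lemma likelihood_cons n t x (beta y : n.-tuple R) :
  likelihood n.+1 (tcons n t beta) (tcons n x y) =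
  likelihood1 t x * likelihood n beta y.
Proof.
rewrite /likelihood big_ord_recl expRD; congr (_ * expR _).
by apply: eq_bigr => i _; rewrite !tnthS.
Qed.

Lemma normal_pdf_likelihood (t x : R) :
  normal_pdf t 1 x = likelihood1 t x * normal_pdf 0 1 x.
Proof.
rewrite !normal_pdfE// mulrCA; congr (_ * _); rewrite /normal_fun -expRD.
by congr expR; field.
Qed.

Lemma measurable_likelihood1 (t : R) : measurable_fun setT (likelihood1 t).
Proof.
by apply: measurableT_comp => //; apply: measurable_funB => //; exact: measurable_funM.
Qed.

(** With a reference law that does not depend on [beta], the risk becomes an integral of a jointly
    measurable function, so Tonelli's theorem applies when it is averaged over [beta]. *)
Lemma ge0_integral_mvnormal_likelihood n (beta : n.-tuple R) (f : n.-tuple R -> \bar R) :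
  measurable_fun setT f -> (forall y, 0 <= f y)%E ->
  (\int[mvnormal beta]_y f y =
   \int[std_mvnormal n]_y (f y * (likelihood n beta y)%:E))%E.
Proof.
have mL k (b : k.-tuple R) : measurable_fun setT (fun y => (likelihood k b y)%:E).
  apply/measurable_EFinP; apply: measurableT_comp => //.
  apply: measurable_sum => i; apply: measurable_funB => //.
  by apply: measurable_funM => //; exact: measurable_tnth.
elim: n beta f => [beta f mf f0|n IH beta f mf f0].
  rewrite /std_mvnormal (tuple0 beta) (tuple0 (zero_tuple 0)).
  apply: eq_integral => y _.
  by rewrite /likelihood big_ord0 expR0 mule1.
have mg : measurable_fun setT (fun y => f y * (likelihood n.+1 beta y)%:E)%E.
  by apply: emeasurable_funM => //; exact: mL.
have g0 y : (0 <= f y * (likelihood n.+1 beta y)%:E)%E.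
  by rewrite mule_ge0// lee_fin expR_ge0.
apply: (eq_trans (ge0_integral_mvnormalS n beta f mf f0)).
apply: (eq_trans _ (esym (ge0_integral_std_mvnormalS n _ mg g0))).
have mfc : measurable_fun setT (fun w : measurableTypeR R * n.-tuple R => f (tcons n w.1 w.2)).
  exact: measurableT_comp mf (measurable_tcons n).
have mgc : measurable_fun setT (fun w : measurableTypeR R * n.-tuple R =>
    f (tcons n w.1 w.2) * (likelihood n (behead_tuple beta) w.2)%:E)%E.
  apply: emeasurable_funM => //.
  by apply: (measurableT_comp (mL n (behead_tuple beta))).
have lk0 (v : n.-tuple R) : (0 <= (likelihood n (behead_tuple beta) v)%:E)%E.
  by rewrite lee_fin expR_ge0.
pose J u := (\int[std_mvnormal n]_v
  (f (tcons n u v) * (likelihood n (behead_tuple beta) v)%:E))%E.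
have mJ : measurable_fun setT J.
  apply: (measurable_partial_integral _ _ _ _ (std_mvnormal n) (fun u v =>
    f (tcons n u v) * (likelihood n (behead_tuple beta) v)%:E)%E mgc) => u v.
  by rewrite mule_ge0.
have J0 u : (0 <= J u)%E by apply: integral_ge0 => v _; rewrite mule_ge0.
transitivity (\int[normal_prob (thead beta) 1]_u J u)%E.
  apply: eq_integral => u _; apply: IH => //.
  apply: measurableT_comp mf _.
  by apply: measurable_cons => //; exact: measurable_cst.
transitivity (\int[gauss]_u ((likelihood1 (thead beta) u)%:E * J u))%E; last first.
  apply: eq_integral => u _; rewrite /J -ge0_integralZl//.
  - apply: eq_integral => v _; rewrite [in RHS](tuple_eta beta).
    by rewrite -[in RHS]/(tcons _ _ _) likelihood_cons EFinM muleCA.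
  - apply: emeasurable_funM; last exact: mL.
    apply: (measurableT_comp mf).
    by apply: measurable_cons => //; exact: measurable_cst.
  - by move=> v _; rewrite mule_ge0.
  - by rewrite lee_fin expR_ge0.
have mlJ : measurable_fun setT (fun u => (likelihood1 (thead beta) u)%:E * J u)%E.
  by apply: emeasurable_funM => //; apply/measurable_EFinP; exact: measurable_likelihood1.
rewrite (ge0_integral_normal_prob _ _ J mJ J0).
rewrite (ge0_integral_normal_prob _ _ _ mlJ); last first.
  by move=> u; rewrite mule_ge0// lee_fin expR_ge0.
apply: eq_integral => u _; rewrite normal_pdf_likelihood EFinM muleCA.
by rewrite muleA.
Qed.

End likelihood.

(** * The Bayes risk of one coordinate under a normal prior *)

Section bayes_average.
Context {R : realType}.
Notation gauss := (@normal_prob R 0 1 : probability (measurableTypeR R) R).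
Notation std := (@std_mvnormal R).
Variable tau : R.
Hypothesis tau_gt0 : 0 < tau.

(** The posterior variance of one coordinate under the prior N(0, tau^2). *)
Definition bayes_value : R := tau ^+ 2 / (1 + tau ^+ 2).
Notation V := bayes_value.

Let tau1 : 0 < 1 + tau ^+ 2. Proof. by rewrite ltr_pwDl// sqr_ge0. Qed.

Lemma bayes_value_ge0 : 0 <= V.
Proof. by rewrite divr_ge0 ?sqr_ge0// ltW. Qed.

(* Given [y], the posterior of [z] is normal with mean [tau y s ^ 2] and
   standard deviation [s = (1 + tau ^ 2) ^ (-1/2)]. *)
Lemma posterior_density (y : R) : exists (M m s : R),
  [/\ 0 <= M, 0 < s, V = tau ^+ 2 * s ^+ 2 & forall z,
  likelihood1 (tau * z) y * normal_pdf 0 1 z = M * normal_pdf m s z].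
Proof.
pose s := (Num.sqrt (1 + tau ^+ 2))^-1.
have s0 : 0 < s by rewrite invr_gt0 sqrtr_gt0.
have s2 : s ^+ 2 = (1 + tau ^+ 2)^-1 by rewrite exprVn sqr_sqrtr// ltW.
pose m := tau * y * s ^+ 2.
have pk : 0 < normal_peak s by rewrite normal_peak_gt0// gt_eqF.
exists (normal_peak 1 / normal_peak s * expR (m ^+ 2 / (s ^+ 2 *+ 2))), m, s; split => //.
- by rewrite !mulr_ge0 ?expR_ge0 ?invr_ge0 ?normal_peak_ge0.
- by rewrite s2.
move=> z; rewrite !normal_pdfE ?gt_eqF// /normal_fun /likelihood1.
rewrite [RHS](_ : _ = normal_peak 1 * (expR (m ^+ 2 / (s ^+ 2 *+ 2)) *
   expR (- (z - m) ^+ 2 / (s ^+ 2 *+ 2)))); last by field; rewrite gt_eqF.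
rewrite mulrCA -!expRD; congr (_ * expR _).
by rewrite /m s2; field; rewrite gt_eqF.
Qed.

(** The integral is squared bias plus variance, k^2 + tau^2 s^2. It comes from the Stein identity:
    [F] is chosen so that (c - tau z)^2 = k^2 - F(z) (z - m), and its derivative is -tau^2. *)
Lemma normal_sqr_ge (c m s : R) : 0 < s ->
  ((tau ^+ 2 * s ^+ 2)%:E <=
   \int[lebesgue_measure]_z ((c - tau * z) ^+ 2 * normal_pdf m s z)%:E)%E.
Proof.
move=> s0; pose k := c - tau * m.
pose F z := - tau ^+ 2 * (z - m) + 2 * k * tau.
pose C := 2 * tau ^+ 2 + 2 * `|k| * tau + k ^+ 2.
have tau2 := sqr_ge0 tau; have k2 := sqr_ge0 k.
have kt : 0 <= `|k| * tau by rewrite mulr_ge0// ltW.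
have le1 (u : R) : `|u| <= 1 + u ^+ 2.
  rewrite -[u ^+ 2]real_normK ?num_real//; move: `|u| (normr_ge0 u) => t t0; nra.
have kn (u : R) : `|2 * k * tau * u| = 2 * `|k| * tau * `|u|.
  by rewrite !normrM (ger0_norm (ltW tau_gt0)) ger0_norm.
have C1 (u : R) : tau ^+ 2 <= C * (1 + u ^+ 2).
  have := sqr_ge0 u; rewrite /C; nra.
have C2 (u : R) : `|- tau ^+ 2 * u + 2 * k * tau| <= C * (1 + u ^+ 2).
  rewrite (le_trans (ler_normD _ _))// -[2 * k * tau]mulr1 kn normr1 mulr1.
  rewrite normrM normrN (ger0_norm (sqr_ge0 tau)).
  have := le1 u; have := sqr_ge0 u; rewrite /C; nra.
have C3 (u : R) : `|(- tau ^+ 2 * u + 2 * k * tau) * u| <= C * (1 + u ^+ 2).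
  rewrite mulrDl (le_trans (ler_normD _ _))// kn.
  rewrite -mulrA normrM normrN (ger0_norm (sqr_ge0 tau)).
  rewrite -expr2 (ger0_norm (sqr_ge0 u)).
  have := le1 u; have := sqr_ge0 u; rewrite /C; nra.
have dF (z : R) : is_derive z 1 F (- tau ^+ 2).
  have d0 : is_derive z 1 (fun z => z - m) 1.
    by rewrite -[X in is_derive _ _ _ X]subr0; apply: is_deriveB.
  have := @is_deriveD _ _ _ _ _ _ _ _ _ (@is_deriveZ _ _ _ _ (- tau ^+ 2) _ _ _ d0)
    (@is_derive_cst _ _ _ (2 * k * tau) z 1).
  by rewrite /GRing.scale/= mulr1 addr0.
have cc : continuous (fun _ : R => - tau ^+ 2) by move=> z; exact: cvg_cst.
have C1' (u : R) : `|- tau ^+ 2| <= C * (1 + u ^+ 2).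
  by rewrite normrN ger0_norm.
have st := stein_lebesgue m s F (fun=> - tau ^+ 2) C s0 dF
  cc (fun z => C2 (z - m)) (fun z => C3 (z - m)).
have {}st := st (fun z => C1' (z - m)).
pose f z := (c - tau * z) ^+ 2.
have mf : measurable_fun setT f.
  apply: measurable_funX; apply: measurable_funB => //; exact: measurable_funM.
have fE z : f z = k ^+ 2 + tau ^+ 2 * s ^+ 2
    + (s ^+ 2 * - tau ^+ 2 - F z * (z - m)) by rewrite /f /F /k; ring.
have fC z : `|f z| <= (k ^+ 2 + C) * (1 + (z - m) ^+ 2).
  rewrite (_ : f z = k ^+ 2 - (- tau ^+ 2 * (z - m) + 2 * k * tau) * (z - m)); last first.
    by rewrite /f /k; ring.
  rewrite (le_trans (ler_normB _ _))// [leRHS]mulrDl lerD//.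
  rewrite ger0_norm// ler_peMr// lerDl sqr_ge0//.
have if1 := integrable_sqr_normal_pdf m s f _ s0 mf fC.
have ip := integrable_normal_pdf m s.
have if2 : lebesgue_measure.-integrable setT (EFin \o (fun z =>
    (s ^+ 2 * - tau ^+ 2 - F z * (z - m)) * normal_pdf m s z)).
  pose g z := s ^+ 2 * - tau ^+ 2 - F z * (z - m).
  have mF : measurable_fun setT F.
    by apply: measurable_funD => //; apply: measurable_funM => //; exact: measurable_funB.
  have mg : measurable_fun setT g.
    by apply: measurable_funB => //; apply: measurable_funM => //; exact: measurable_funB.
  apply: (integrable_sqr_normal_pdf m s g (s ^+ 2 * C + C)) => // z.
  rewrite (le_trans (ler_normB _ _))// [leRHS]mulrDl lerD//; last exact: C3.
  by rewrite normrM (ger0_norm (sqr_ge0 s)) -[leRHS]mulrA ler_wpM2l ?sqr_ge0//.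
have E1 : (\int[lebesgue_measure]_z (f z * normal_pdf m s z)%:E =
    (k ^+ 2 + tau ^+ 2 * s ^+ 2)%:E)%E.
  transitivity (\int[lebesgue_measure]_z (((k ^+ 2 + tau ^+ 2 * s ^+ 2)%:E * (normal_pdf m s z)%:E)
     + ((s ^+ 2 * - tau ^+ 2 - F z * (z - m)) * normal_pdf m s z)%:E))%E.
    apply: eq_integral => z _; rewrite -EFinM -EFinD; congr EFin.
    by rewrite fE; ring.
  rewrite integralD//; last exact: integrableZl.
  rewrite integralZl// integral_normal_pdf mule1.
  rewrite -[X in (_ + X)%E]fineK; last exact: integrable_fin_num if2.
  by rewrite -[fine _]/(Rintegral _ _ _) st adde0.
by rewrite E1 lee_fin lerDr.
Qed.

Lemma bayes_posterior (c y : R) :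
  (V%:E * \int[gauss]_z (likelihood1 (tau * z) y)%:E <=
   \int[gauss]_z ((c - tau * z) ^+ 2 * likelihood1 (tau * z) y)%:E)%E.
Proof.
have [M [m [s [M0 s0 VE dens]]]] := posterior_density y.
have mL : measurable_fun setT (fun z => likelihood1 (tau * z) y).
  apply: measurableT_comp => //; apply: measurable_funB => //.
    by apply: measurable_funM => //; exact: measurable_funM.
  by apply: measurable_funM => //; apply: measurable_funX; exact: measurable_funM.
have mc : measurable_fun setT (fun z => (c - tau * z) ^+ 2).
  by apply: measurable_funX; apply: measurable_funB => //; exact: measurable_funM.
rewrite !ge0_integral_normal_prob.
- have -> : (\int[lebesgue_measure]_z ((likelihood1 (tau * z) y)%:E * (normal_pdf 0 1 z)%:E)
      = M%:E)%E.
    transitivity (\int[lebesgue_measure]_z (M%:E * (normal_pdf m s z)%:E))%E.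
      by apply: eq_integral => z _; rewrite -!EFinM dens.
    by rewrite integralZl//; [rewrite integral_normal_pdf mule1|exact: integrable_normal_pdf].
  have -> : (\int[lebesgue_measure]_z (((c - tau * z) ^+ 2 * likelihood1 (tau * z) y)%:E *
        (normal_pdf 0 1 z)%:E) =
      M%:E * \int[lebesgue_measure]_z ((c - tau * z) ^+ 2 * normal_pdf m s z)%:E)%E.
    rewrite -ge0_integralZl//.
    + by apply: eq_integral => z _; rewrite -!EFinM -mulrA dens mulrCA.
    + apply/measurable_EFinP; apply: measurable_funM => //.
      exact: measurable_normal_pdf.
    + by move=> z _; rewrite lee_fin mulr_ge0 ?sqr_ge0 ?normal_pdf_ge0.
  by rewrite muleC VE lee_wpmul2l ?lee_fin ?normal_sqr_ge.
- by apply/measurable_EFinP; exact: measurable_funM.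
- by move=> z; rewrite lee_fin mulr_ge0 ?sqr_ge0 ?expR_ge0.
- exact/measurable_EFinP.
- by move=> z; rewrite lee_fin expR_ge0.
Qed.


End bayes_average.

Section average_risk.
Context {R : realType}.
Notation gauss := (@normal_prob R 0 1 : probability (measurableTypeR R) R).
Notation std := (@std_mvnormal R).
Variable tau : R.
Hypothesis tau_gt0 : 0 < tau.
Notation V := (bayes_value tau).

Definition scale_tuple n (z : n.-tuple R) : n.-tuple R :=
  [tuple tau * tnth z i | i < n].

Lemma scale_tcons n (u : R) (z : n.-tuple R) :
  scale_tuple n.+1 (tcons n u z) = tcons n (tau * u) (scale_tuple n z).
Proof.
apply: eq_from_tnth => j; rewrite tnth_mktuple.
by case: (unliftP ord0 j) => [k|] -> //; rewrite !tnthS tnth_mktuple.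
Qed.

Lemma measurable_scale_tuple n : measurable_fun setT (scale_tuple n).
Proof.
apply/measurable_fun_tnthP => i; rewrite /comp.
under eq_fun do rewrite tnth_mktuple.
by apply: measurable_funM => //; exact: measurable_tnth.
Qed.

(** The joint density of [z] and [y], relative to independent standard normal vectors, when the
    parameter is [tau * z]. *)
Definition joint_density n (w : n.-tuple R * n.-tuple R) : R :=
  likelihood n (scale_tuple n w.1) w.2.

Lemma joint_density_ge0 n w : 0 <= joint_density n w.
Proof. exact: expR_ge0. Qed.

Lemma measurable_tnth_fst n (i : 'I_n) :
  measurable_fun setT (fun w : n.-tuple R * n.-tuple R => tnth w.1 i).
Proof. by apply: measurableT_comp (measurable_tnth i) _. Qed.

Lemma measurable_joint_density n : measurable_fun setT (joint_density n).
Proof.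
apply: measurableT_comp => //; apply: measurable_sum => i.
have mb : measurable_fun setT (fun w : n.-tuple R * n.-tuple R => tnth (scale_tuple n w.1) i).
  apply: measurableT_comp (measurable_tnth i) _.
  by apply: measurableT_comp (measurable_scale_tuple n) _.
apply: measurable_funB; first apply: measurable_funM => //.
  by apply: measurableT_comp (measurable_tnth i) _.
by apply: measurable_funM => //; exact: measurable_funX.
Qed.

Lemma joint_density_tcons n (u x : R) (z y : n.-tuple R) :
  joint_density n.+1 (tcons n u z, tcons n x y) =
  likelihood1 (tau * u) x * joint_density n (z, y).
Proof. by rewrite /joint_density /= scale_tcons likelihood_cons. Qed.

Definition joint_density1 (w : measurableTypeR R * measurableTypeR R) : R :=
  likelihood1 (tau * w.1) w.2.

Lemma measurable_joint_density1 : measurable_fun setT joint_density1.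
Proof.
apply: measurableT_comp => //; apply: measurable_funB.
  by apply: measurable_funM => //; apply: measurable_funM => //; exact: measurable_fst.
by apply: measurable_funM => //; apply: measurable_funX; exact: measurable_funM.
Qed.

Lemma integral_likelihood n (beta : n.-tuple R) :
  (\int[std n]_y (likelihood n beta y)%:E = 1)%E.
Proof.
transitivity (\int[mvnormal beta]_y (cst 1 y))%E.
  apply: esym; apply: (eq_trans (ge0_integral_mvnormal_likelihood n beta (cst 1%E) _ _)) => //.
  by apply: eq_integral => y _; rewrite mul1e.
by rewrite integral_cst//; rewrite mul1e; exact: probability_setT.
Qed.

Lemma integral_likelihood1 (t : R) : (\int[gauss]_y (likelihood1 t y)%:E = 1)%E.
Proof.
rewrite ge0_integral_normal_prob.
- rewrite -(integral_normal_pdf t 1); apply: eq_integral => y _.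
  by rewrite (normal_pdf_likelihood t) EFinM.
- by apply/measurable_EFinP; exact: measurable_likelihood1.
- by move=> y; rewrite lee_fin expR_ge0.
Qed.

Lemma integral_joint_density n :
  (\int[(std n \x std n)]_w (joint_density n w)%:E = 1)%E.
Proof.
apply: (eq_trans (esym (tonelli_prod _ _ _ _ (std n) (std n)
  (fun z y => (joint_density n (z, y))%:E) _ _))).
- apply/measurable_EFinP; under eq_fun do rewrite -surjective_pairing.
  exact: measurable_joint_density.
- by move=> z y; rewrite lee_fin joint_density_ge0.
transitivity (\int[std n]_z (cst 1 z))%E.
  by apply: eq_integral => z _; exact: (integral_likelihood n (scale_tuple n z)).
by rewrite integral_cst// mul1e; exact: probability_setT.
Qed.

Lemma integral_joint_density1 :
  (\int[(gauss \x gauss)]_w (joint_density1 w)%:E = 1)%E.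
Proof.
apply: (eq_trans (esym (tonelli_prod _ _ _ _ gauss gauss
  (fun z y => (joint_density1 (z, y))%:E) _ _))).
- apply/measurable_EFinP; under eq_fun do rewrite -surjective_pairing.
  exact: measurable_joint_density1.
- by move=> z y; rewrite lee_fin expR_ge0.
transitivity (\int[gauss]_z (cst 1 z))%E.
  by apply: eq_integral => z _; exact: (integral_likelihood1 (tau * z)).
by rewrite integral_cst// mul1e; exact: probability_setT.
Qed.

(** Exchanging the integrals puts the parameter inside, where [bayes_posterior] bounds the integral
    for each observation; the likelihood has total mass 1. *)
Lemma average_risk1 (c : R -> R) : measurable_fun setT c ->
  (V%:E <= \int[(gauss \x gauss)]_w
     ((c w.2 - tau * w.1) ^+ 2 * joint_density1 w)%:E)%E.
Proof.
move=> mc.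
have mf : measurable_fun setT (fun w : measurableTypeR R * measurableTypeR R =>
    ((c w.2 - tau * w.1) ^+ 2 * joint_density1 (w.1, w.2))%:E).
  apply/measurable_EFinP; apply: measurable_funM.
    apply: measurable_funX; apply: measurable_funB.
      by apply: measurableT_comp mc _; exact: measurable_snd.
    by apply: measurable_funM => //; exact: measurable_fst.
  under eq_fun do rewrite -surjective_pairing.
  exact: measurable_joint_density1.
have f0 z y : (0 <= ((c y - tau * z) ^+ 2 * joint_density1 (z, y))%:E)%E.
  by rewrite lee_fin mulr_ge0 ?sqr_ge0 ?expR_ge0.
have mk : measurable_fun setT (fun w : measurableTypeR R * measurableTypeR R =>
    (joint_density1 (w.2, w.1))%:E).
  apply/measurable_EFinP; apply: measurableT_comp measurable_joint_density1 _.
  by apply: measurable_fun_pair; [exact: measurable_snd|exact: measurable_fst].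
have mswap : measurable_fun setT (fun w : measurableTypeR R * measurableTypeR R =>
    ((c w.1 - tau * w.2) ^+ 2 * joint_density1 (w.2, w.1))%:E).
  apply: (measurableT_comp mf (g := fun w => (w.2, w.1))).
  by apply: measurable_fun_pair; [exact: measurable_snd|exact: measurable_fst].
have E : (\int[gauss]_z \int[gauss]_y ((c y - tau * z) ^+ 2 * joint_density1 (z, y))%:E =
   \int[(gauss \x gauss)]_w ((c w.2 - tau * w.1) ^+ 2 * joint_density1 w)%:E)%E.
  apply: (eq_trans (tonelli_prod _ _ _ _ gauss gauss (fun z y =>
    ((c y - tau * z) ^+ 2 * joint_density1 (z, y))%:E) mf f0)).
  by apply: eq_integral => -[].
rewrite -E.
have -> := tonelli_swap _ _ _ _ gauss gauss (fun z y =>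
    ((c y - tau * z) ^+ 2 * joint_density1 (z, y))%:E) mf f0.
have k0 z y : (0 <= (joint_density1 (z, y))%:E)%E by rewrite lee_fin expR_ge0.
have mIk : measurable_fun setT (fun y => \int[gauss]_z (joint_density1 (z, y))%:E)%E.
  exact: (measurable_partial_integral _ _ _ _ gauss (fun y z => (joint_density1 (z, y))%:E) mk).
have EV : (\int[gauss]_y (V%:E * \int[gauss]_z (joint_density1 (z, y))%:E) = V%:E)%E.
  rewrite ge0_integralZl//.
  - rewrite (tonelli_swap _ _ _ _ gauss gauss (fun y z => (joint_density1 (z, y))%:E))//.
    rewrite (eq_integral (cst 1%E)); last first.
      by move=> z _; exact: (integral_likelihood1 (tau * z)).
    by rewrite integral_cst// mul1e [X in (_ * X)%E]probability_setT mule1.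
  - by move=> y _; exact: integral_ge0.
  - by rewrite lee_fin bayes_value_ge0.
rewrite -[X in (X <= _)%E]EV; apply: ge0_le_integral => //.
- by move=> y _; rewrite mule_ge0 ?integral_ge0// lee_fin bayes_value_ge0.
- exact: emeasurable_funM.
- exact: (measurable_partial_integral _ _ _ _ gauss (fun y z =>
    ((c y - tau * z) ^+ 2 * joint_density1 (z, y))%:E) mswap).
- by move=> y _; exact: bayes_posterior.
Qed.

End average_risk.

(** * No estimator has supremal risk below the dimension *)

Section minimax_lower_bound.
Context {R : realType}.
Notation gauss := (@normal_prob R 0 1 : probability (measurableTypeR R) R).
Notation std := (@std_mvnormal R).

Lemma le_integral_density d (T : measurableType d) (P : probability T R)
    (k : T -> R) (f : T -> \bar R) (c : R) : 0 <= c ->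
  measurable_fun setT k -> (forall x, 0 <= k x) ->
  (\int[P]_x (k x)%:E = 1)%E ->
  measurable_fun setT f -> (forall x, ((k x)%:E * c%:E <= f x)%E) ->
  (c%:E <= \int[P]_x f x)%E.
Proof.
move=> c0 mk k0 k1 mf kf.
have mk' : measurable_fun setT (fun x => (k x)%:E) by exact/measurable_EFinP.
rewrite -[X in (X <= _)%E]mul1e -k1 -ge0_integralZr//; last by move=> x _; rewrite lee_fin.
apply: ge0_le_integral => //.
- by move=> x _; rewrite mule_ge0// lee_fin.
- exact: emeasurable_funM.
Qed.

Lemma measurable_tcons_pair d (T : measurableType d) n (u : T -> R)
    (v : T -> n.-tuple R) : measurable_fun setT u -> measurable_fun setT v ->
  measurable_fun setT (fun t => tcons n (u t) (v t)).
Proof. by move=> mu mv; apply: measurable_cons. Qed.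

Variable tau : R.
Hypothesis tau_gt0 : 0 < tau.
Notation V := (bayes_value tau).
Notation jd := (joint_density tau).

Lemma measurable_coordinate_loss n (i : 'I_n) (g : n.-tuple R -> R) :
  measurable_fun setT g ->
  measurable_fun setT (fun w : n.-tuple R * n.-tuple R =>
    ((g w.2 - tau * tnth w.1 i) ^+ 2 * jd n w)%:E).
Proof.
move=> mg; apply/measurable_EFinP; apply: measurable_funM; last exact: measurable_joint_density.
apply: measurable_funX; apply: measurable_funB; first exact: measurableT_comp.
by apply: measurable_funM => //; exact: measurable_tnth_fst.
Qed.

(** The estimate of coordinate [i] may use all of [y], but the joint density factorises over the
    coordinates. With the head pair (parameter, observation) fixed, a tail coordinate falls under
    the induction hypothesis; with the tail pair fixed, the head falls under [average_risk1]. *)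
Lemma average_risk n (i : 'I_n) (g : n.-tuple R -> R) : measurable_fun setT g ->
  (V%:E <= \int[(std n \x std n)]_w
     ((g w.2 - tau * tnth w.1 i) ^+ 2 * jd n w)%:E)%E.
Proof.
elim: n i g => [[]//|n IH i g mg].
pose H z y := ((g y - tau * tnth z i) ^+ 2 * jd n.+1 (z, y))%:E.
have H0 z y : (0 <= H z y)%E by rewrite lee_fin mulr_ge0 ?sqr_ge0 ?joint_density_ge0.
have mH : measurable_fun setT (fun w : n.+1.-tuple R * n.+1.-tuple R => H w.1 w.2).
  rewrite /H; under eq_fun do rewrite -surjective_pairing.
  exact: measurable_coordinate_loss.
pose F z0 z y0 y := H (tcons n z0 z) (tcons n y0 y).
have F0 z0 z y0 y : (0 <= F z0 z y0 y)%E by exact: H0.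
have mF : measurable_fun setT
    (fun w : (measurableTypeR R * n.-tuple R) * (measurableTypeR R * n.-tuple R) =>
       F w.1.1 w.1.2 w.2.1 w.2.2).
  apply: (measurableT_comp mH (g := fun w => (tcons n w.1.1 w.1.2, tcons n w.2.1 w.2.2))).
  apply: measurable_fun_pair; first by apply: measurableT_comp (measurable_tcons n) _.
  by apply: measurableT_comp (measurable_tcons n) _.
have mHy (z : n.+1.-tuple R) : measurable_fun setT (H z).
  by apply: (measurableT_comp mH (g := pair z)); exact: measurable_pair1.
have E : (\int[(std n.+1 \x std n.+1)]_w
     ((g w.2 - tau * tnth w.1 i) ^+ 2 * jd n.+1 w)%:E =
   \int[(gauss \x gauss)]_w \int[(std n \x std n)]_x F w.1 x.1 w.2 x.2)%E.
  transitivity (\int[std n.+1]_z \int[std n.+1]_y H z y)%E.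
    apply: esym; apply: (eq_trans (tonelli_prod _ _ _ _ (std n.+1) (std n.+1) H mH H0)).
    by apply: eq_integral => -[].
  apply: (eq_trans (ge0_integral_std_mvnormalS n (fun z => \int[std n.+1]_y H z y)%E
    (measurable_partial_integral _ _ _ _ (std n.+1) H mH H0) _)).
    by move=> z; exact: integral_ge0.
  apply: eq_trans (tonelli4 _ _ _ _ _ _ _ _ gauss (std n) gauss (std n) F mF F0).
  apply: eq_integral => z0 _; apply: eq_integral => z _.
  exact: (ge0_integral_std_mvnormalS n (H (tcons n z0 z)) (mHy _) (H0 _)).
rewrite E {E}.
have mreg := measurable_regroup _ _ _ _ _ _ _ _ F mF.
have FE z0 z y0 y : F z0 z y0 y = ((g (tcons n y0 y) - tau * tnth (tcons n z0 z) i) ^+ 2 *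
  (joint_density1 tau (z0, y0) * jd n (z, y)))%:E.
  by rewrite /F /H joint_density_tcons.
have mgc y0 : measurable_fun setT (fun y => g (tcons n y0 y)).
  by apply: measurableT_comp mg _; apply: measurable_tcons_pair.
have mgc0 (y : n.-tuple R) : measurable_fun setT (fun y0 => g (tcons n y0 y)).
  by apply: measurableT_comp mg _; apply: measurable_tcons_pair.
have V0 := bayes_value_ge0 tau.
case: (unliftP ord0 i) => [j|] iE.
  apply: (le_integral_density _ _ (gauss \x gauss)%E (joint_density1 tau)) => //.
  - exact: measurable_joint_density1.
  - by move=> w; exact: expR_ge0.
  - exact: integral_joint_density1.
  - exact: (measurable_partial_integral _ _ _ _ (std n \x std n)%E
      (fun w x => F w.1 x.1 w.2 x.2) mreg (fun w x => F0 _ _ _ _)).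
  move=> w; have := IH j _ (mgc w.2) => IHj.
  apply: (@le_trans _ _ ((joint_density1 tau w)%:E * \int[(std n \x std n)]_x
     ((g (tcons n w.2 x.2) - tau * tnth x.1 j) ^+ 2 * jd n x)%:E)%E).
    by rewrite lee_wpmul2l// lee_fin expR_ge0.
  rewrite -ge0_integralZl.
  - rewrite le_eqVlt; apply/orP; left; apply/eqP; apply: eq_integral => x _.
    rewrite FE iE tnthS -EFinM; congr EFin.
    by rewrite -!surjective_pairing; ring.
  - exact: measurableT.
  - exact: measurable_coordinate_loss (mgc w.2).
  - by move=> x _; rewrite lee_fin mulr_ge0 ?sqr_ge0 ?joint_density_ge0.
  - by rewrite lee_fin expR_ge0.
have -> := tonelli_swap _ _ _ _ (gauss \x gauss)%E (std n \x std n)%E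
   (fun w x => F w.1 x.1 w.2 x.2) mreg (fun w x => F0 _ _ _ _).
have mreg' : measurable_fun setT (fun w : (n.-tuple R * n.-tuple R) *
    (measurableTypeR R * measurableTypeR R) => F w.2.1 w.1.1 w.2.2 w.1.2).
  apply: (measurableT_comp mreg (g := fun w => (w.2, w.1))).
  by apply: measurable_fun_pair; [exact: measurable_snd|exact: measurable_fst].
apply: (le_integral_density _ _ (std n \x std n)%E (jd n)) => //.
- exact: measurable_joint_density.
- by move=> x; exact: expR_ge0.
- exact: integral_joint_density.
- exact: (measurable_partial_integral _ _ _ _ (gauss \x gauss)%E
    (fun x w => F w.1 x.1 w.2 x.2) mreg' (fun w x => F0 _ _ _ _)).
move=> x; have r1 := average_risk1 tau tau_gt0 _ (mgc0 x.2).
apply: (@le_trans _ _ ((jd n x)%:E * \int[(gauss \x gauss)]_w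
   ((g (tcons n w.2 x.2) - tau * w.1) ^+ 2 * joint_density1 tau w)%:E)%E).
  by rewrite lee_wpmul2l// lee_fin expR_ge0.
rewrite -ge0_integralZl.
- rewrite le_eqVlt; apply/orP; left; apply/eqP; apply: eq_integral => w _.
  rewrite FE iE -EFinM; congr EFin.
  by rewrite -!surjective_pairing -[tnth (tcons _ _ _) ord0]/(w.1); ring.
- exact: measurableT.
- apply/measurable_EFinP; apply: measurable_funM; last exact: measurable_joint_density1.
  apply: measurable_funX; apply: measurable_funB.
    by apply: (measurableT_comp (mgc0 x.2)); exact: measurable_snd.
  by apply: measurable_funM => //; exact: measurable_fst.
- by move=> w _; rewrite lee_fin mulr_ge0 ?sqr_ge0 ?expR_ge0.
- by rewrite lee_fin expR_ge0.
Qed.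

(** The supremum of the risk is at least its average under the prior, and that average splits into
    coordinates. All integrands are nonnegative, so infinite risks are covered. *)
Lemma sup_risk_ge_bayes n (delta : n.-tuple R -> n.-tuple R) :
  measurable_fun setT delta -> ((n%:R * V)%:E <= sup_risk delta)%E.
Proof.
move=> mdelta.
pose loss (z y : n.-tuple R) := quadratic_loss (delta y) (scale_tuple tau n z).
have lossE z y : loss z y = \sum_(i < n) (tnth (delta y) i - tau * tnth z i) ^+ 2.
  by apply: eq_bigr => i _; rewrite !tnth_mktuple.
have md i : measurable_fun setT (fun y => tnth (delta y) i).
  by apply: measurableT_comp (measurable_tnth i) _.
pose G z y := (loss z y * jd n (z, y))%:E.
have GE (z y : n.-tuple R) : G z y =
   (\sum_(i < n) ((tnth (delta y) i - tau * tnth z i) ^+ 2 * jd n (z, y))%:E)%E.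
  by rewrite sumEFin -mulr_suml -lossE.
have G0 z y : (0 <= G z y)%E.
  by rewrite lee_fin mulr_ge0 ?joint_density_ge0// sqnorm_ge0.
have mG : measurable_fun setT (fun w : n.-tuple R * n.-tuple R => G w.1 w.2).
  under eq_fun do rewrite GE -surjective_pairing.
  by apply: emeasurable_sum => i; exact: measurable_coordinate_loss (md i).
have mrisk : measurable_fun setT (fun z => \int[std n]_y G z y)%E.
  exact: (measurable_partial_integral _ _ _ _ (std n) G mG G0).
have riskE z : risk delta (scale_tuple tau n z) = (\int[std n]_y G z y)%E.
  rewrite /risk unlock.
  apply: (eq_trans (ge0_integral_mvnormal_likelihood n _ (fun y => (loss z y)%:E) _ _)).
  - apply/measurable_EFinP; rewrite (funext (lossE z)).
    apply: measurable_sum => i; apply: measurable_funX; exact: measurable_funB.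
  - by move=> y; rewrite lee_fin sqnorm_ge0.
  - by apply: eq_integral => y _; rewrite /G EFinM.
apply: (@le_trans _ _ (\int[std n]_z \int[std n]_y G z y)%E).
  apply: (@le_trans _ _ (\int[(std n \x std n)]_w G w.1 w.2)%E); last first.
    by rewrite (tonelli_prod _ _ _ _ (std n) (std n) G mG G0).
  under eq_integral do rewrite GE -surjective_pairing.
  rewrite ge0_integral_sum//.
  - rewrite -[n in n%:R]card_ord -sum1_card natr_sum mulr_suml -sumEFin.
    by apply: lee_sum => i _; rewrite mul1r; apply: average_risk (md i).
  - by move=> i; exact: measurable_coordinate_loss (md i).
  - by move=> i w _; rewrite lee_fin mulr_ge0 ?sqr_ge0 ?joint_density_ge0.
have -> : sup_risk delta = (\int[std n]_z cst (sup_risk delta) z)%E.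
  by rewrite integral_cst// [X in (_ * X)%E]probability_setT mule1.
apply: ge0_le_integral => //.
- by move=> z _; exact: integral_ge0.
- by move=> z _; rewrite -riskE; apply: ereal_sup_ubound; exists (scale_tuple tau n z).
Qed.

End minimax_lower_bound.

Lemma sup_risk_ge {R : realType} n (delta : n.-tuple R -> n.-tuple R) :
  measurable_fun setT delta -> ((n%:R)%:E <= sup_risk delta)%E.
Proof.
move=> mdelta; apply/lee_subgt0Pr => e e0; rewrite -EFinB.
(* The gap n / (1 + tau^2) must be at most [e]; the summand 1 gives tau > 0 and tau^2 >= tau >= n /
   e. *)
pose tau : R := 1 + n%:R / e.
have n0 : 0 <= n%:R / e by rewrite divr_ge0// ltW.
have tau0 : 0 < tau by rewrite ltr_pwDl.
apply: le_trans (sup_risk_ge_bayes tau tau0 n delta mdelta).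
rewrite lee_fin /bayes_value lerBlDr -lerBlDl.
have t1 : 0 < 1 + tau ^+ 2 by rewrite ltr_pwDl// sqr_ge0.
have -> : n%:R - n%:R * (tau ^+ 2 / (1 + tau ^+ 2)) = n%:R / (1 + tau ^+ 2).
  by field; rewrite gt_eqF.
rewrite ler_pdivrMr// mulrDr mulr1 -[leLHS]add0r lerD ?(ltW e0)//.
have ne : n%:R = e * (n%:R / e) by rewrite mulrC divfK ?gt_eqF.
rewrite {1}ne ler_pM2l// /tau; nra.
Qed.

(** * Risk of a shrinkage estimator *)

Section shrinkage_risk.
Context {R : realType} (p : nat).
Variables (phi dphi : R -> R).
Hypothesis dphiE : forall w : R, is_derive w 1 phi (dphi w).
Hypothesis cdphi : continuous dphi.
Hypothesis phi_le1 : forall w, 0 <= w -> `|phi w| <= 1.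
Hypothesis dphi_le1 : forall w, 0 <= w -> `|dphi w| <= 1.
Implicit Types y beta : p.-tuple R.

Definition shrinkage y : p.-tuple R :=
  [tuple (1 - phi (sqnorm y / 2)) * tnth y i | i < p].

Let w_ y : R := sqnorm y / 2.

Let w_ge0 y : 0 <= w_ y.
Proof. by rewrite divr_ge0// sqnorm_ge0. Qed.

Let cphi : continuous phi.
Proof. by move=> w; apply/differentiable_continuous/derivable1_diffP; have [] := dphiE w. Qed.

Let mw : measurable_fun setT w_.
Proof. by apply: measurable_funM => //; exact: measurable_sqnorm. Qed.

Let mphi : measurable_fun setT (phi \o w_).
Proof. by apply: measurableT_comp => //; exact: continuous_measurable_fun. Qed.

Let mdphi : measurable_fun setT (dphi \o w_).
Proof. by apply: measurableT_comp => //; exact: continuous_measurable_fun. Qed.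

Lemma measurable_shrinkage : measurable_fun setT shrinkage.
Proof.
apply/measurable_fun_tnthP => i; rewrite /comp /shrinkage.
under eq_fun do rewrite tnth_mktuple.
apply: measurable_funM; last exact: measurable_tnth.
by apply: measurable_funB => //; exact: mphi.
Qed.

Lemma sqnorm_update y i (x : R) :
  sqnorm (update p y i x) = x ^+ 2 + (sqnorm y - tnth y i ^+ 2).
Proof.
rewrite /sqnorm (bigD1 i)//= [in RHS](bigD1 i)//= addrAC subrr add0r.
rewrite tnth_mktuple eqxx; congr (_ + _).
by apply: eq_bigr => j /negbTE ji; rewrite tnth_mktuple ji.
Qed.

Lemma sqr_tnth_le_sqnorm y i : tnth y i ^+ 2 <= sqnorm y.
Proof.
rewrite /sqnorm (bigD1 i)//= lerDl; apply: sumr_ge0 => j _; exact: sqr_ge0.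
Qed.

(** The loss is the sum over [i] of [F beta i y] times (y_i - beta_i), plus phi^2 y_i^2. [D i] is
    the derivative of [F beta i] in y_i; since [w_] is half the squared norm, its own derivative is
    y_i. *)
Let F beta i y := (tnth y i - tnth beta i) - 2 * (phi (w_ y) * tnth y i).
Let D (i : 'I_p) y := 1 - 2 * (phi (w_ y) + dphi (w_ y) * tnth y i ^+ 2).

Let mF beta i : measurable_fun setT (F beta i).
Proof.
apply: measurable_funB; first by apply: measurable_funB => //; exact: measurable_tnth.
apply: measurable_funM => //; apply: measurable_funM; first exact: mphi.
exact: measurable_tnth.
Qed.

Let mD i : measurable_fun setT (D i).
Proof.
apply: measurable_funB => //; apply: measurable_funM => //; apply: measurable_funD.
  exact: mphi.
apply: measurable_funM; first exact: mdphi.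
by apply: measurable_funX; exact: measurable_tnth.
Qed.

Lemma stein_shrinkage beta i : (mvnormal beta).-integrable setT
    (fun y => (D i y - F beta i y * (tnth y i - tnth beta i))%:E) /\
  (\int[mvnormal beta]_y (D i y - F beta i y * (tnth y i - tnth beta i))%:E = 0)%E.
Proof.
pose B := `|tnth beta i|; have B0 : 0 <= B by exact: normr_ge0.
(* From (3t + B)(t + B) <= 5 t^2 + 3 B^2 with t = |y_i|; the last summand serves the bound 3t + B on
   [F]. *)
pose C := 5 + 3 * B ^+ 2 + B.
have B2 : 0 <= B ^+ 2 by exact: sqr_ge0.
have C0 : 0 <= C by rewrite /C; lra.
have tq y : `|tnth y i| ^+ 2 <= sqnorm y.
  by rewrite real_normK ?num_real// sqr_tnth_le_sqnorm.
have Cle y (a : R) : a <= C * (1 + `|tnth y i| ^+ 2) -> a <= C * (1 + sqnorm y).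
  by move=> /le_trans; apply; rewrite ler_wpM2l// lerD2l.
have F1 y : `|F beta i y| <= 3 * `|tnth y i| + B.
  rewrite /F (le_trans (ler_normB _ _))//.
  have := ler_normB (tnth y i) (tnth beta i); rewrite -/B.
  have : `|2 * (phi (w_ y) * tnth y i)| <= 2 * `|tnth y i|.
    rewrite !normrM ger0_norm// ler_wpM2l// -[leRHS]mul1r ler_wpM2r//.
    exact: phi_le1.
  lra.
have FC y : `|F beta i y| <= C * (1 + sqnorm y).
  apply: Cle; apply: (le_trans (F1 y)); rewrite /C.
  move: `|tnth y i| (normr_ge0 (tnth y i)) => t t0.
  have := sqr_ge0 (t - 1); have : 0 <= B * t ^+ 2 by rewrite mulr_ge0// sqr_ge0.
  have : 0 <= B ^+ 2 * t ^+ 2 by rewrite mulr_ge0// sqr_ge0.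
  nra.
have FxC y : `|F beta i y * (tnth y i - tnth beta i)| <= C * (1 + sqnorm y).
  apply: Cle; rewrite normrM.
  apply: (@le_trans _ _ ((3 * `|tnth y i| + B) * (`|tnth y i| + B))).
    by apply: ler_pM => //; exact: ler_normB.
  move: `|tnth y i| (normr_ge0 (tnth y i)) => t t0.
  have := sqr_ge0 (t - B); have : 0 <= B * t ^+ 2 by rewrite mulr_ge0// sqr_ge0.
  have : 0 <= B ^+ 2 * t ^+ 2 by rewrite mulr_ge0// sqr_ge0.
  rewrite /C; nra.
have DC y : `|D i y| <= C * (1 + sqnorm y).
  apply: Cle; rewrite /D (le_trans (ler_normB _ _))// normr1 normrM ger0_norm//.
  have h1 : `|phi (w_ y) + dphi (w_ y) * tnth y i ^+ 2| <= 1 + `|tnth y i| ^+ 2.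
    rewrite (le_trans (ler_normD _ _))// lerD ?phi_le1// normrM normrX.
    by rewrite ler_piMl ?exprn_ge0 ?dphi_le1.
  have : 0 <= `|tnth y i| ^+ 2 by exact: sqr_ge0.
  have : 0 <= B * `|tnth y i| ^+ 2 by rewrite mulr_ge0// sqr_ge0.
  have : 0 <= B ^+ 2 * `|tnth y i| ^+ 2 by rewrite mulr_ge0// sqr_ge0.
  rewrite /C; nra.
split.
  apply: (integrable_mvnormal p beta _ (C + C)).
    apply: measurable_funB => //; apply: measurable_funM => //.
    by apply: measurable_funB => //; exact: measurable_tnth.
  by move=> y; rewrite [leRHS]mulrDl (le_trans (ler_normB _ _))// lerD.
have upd y (x : R) : w_ (update p y i x) = (x ^+ 2 + (sqnorm y - tnth y i ^+ 2)) / 2.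
  by rewrite /w_ sqnorm_update.
have updi y (x : R) : tnth (update p y i x) i = x by rewrite tnth_mktuple eqxx.
apply: (stein_mvnormal p beta i (F beta i) (D i) C) => //.
- move=> y x; set r := sqnorm y - tnth y i ^+ 2.
  pose W (x : R) := (x ^+ 2 + r) / 2.
  have -> : (fun x => F beta i (update p y i x)) =
      (fun x => x - tnth beta i) - 2 \*: ((phi \o W) * id).
    by apply/funext => t; rewrite /F upd updi.
  have -> : D i (update p y i x) = 1 - 2 * (phi (W x) + dphi (W x) * x ^+ 2).
    by rewrite /D upd updi.
  have dW : is_derive x 1 W x.
    have d2 := @is_deriveX _ _ (id : R -> R) 2 x 1 1 (is_derive_id x 1).
    have d3 := @is_deriveD _ _ _ _ _ _ _ _ _ d2 (@is_derive_cst _ _ _ r x 1).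
    have := @is_deriveZ _ _ _ _ (2^-1 : R) _ _ _ d3.
    rewrite exprfctE /GRing.scale/= mulr1 expr1 addr0 mulrA mulVf// mul1r => d.
    rewrite (_ : W = fun x => 2^-1 * (x ^+ 2 + r))//.
    by apply/funext => t; rewrite /W mulrC.
  have dc := @is_derive1_comp _ phi W x _ _ (dphiE (W x)) dW.
  have dm := @is_deriveM _ _ _ _ _ _ _ _ dc (is_derive_id x 1).
  have d0 : is_derive x 1 (fun x => x - tnth beta i) 1.
    by rewrite -[X in is_derive _ _ _ X]subr0; apply: is_deriveB.
  have d := @is_deriveB _ _ _ _ _ _ _ _ _ d0 (@is_deriveZ _ _ _ _ 2 _ _ _ dm).
  apply: (is_derive_eq d); rewrite /GRing.scale/=; ring.
- move=> y; set r := sqnorm y - tnth y i ^+ 2.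
  pose W (x : R) := (x ^+ 2 + r) / 2.
  have -> : (fun x => D i (update p y i x)) =
      (fun x => 1 - 2 * (phi (W x) + dphi (W x) * x ^+ 2)).
    by apply/funext => t; rewrite /D upd updi.
  have cW : continuous W.
    move=> x; apply: cvgM; last exact: cvg_cst.
    by apply: cvgD; [exact: exprn_continuous|exact: cvg_cst].
  move=> x; apply: cvgB; first exact: cvg_cst.
  apply: cvgM; first exact: cvg_cst.
  apply: cvgD; first by apply: continuous_comp; [exact: cW|exact: cphi].
  apply: cvgM; last exact: exprn_continuous.
  by apply: continuous_comp; [exact: cW|exact: cdphi].
Qed.

(** Stein's unbiased risk estimate: by the differential inequality, the loss is at most [p] minus a
    sum of Stein terms [Psi i], each of integral 0. *)
Lemma risk_shrinkage_le beta :
  (forall w, 0 <= w -> 2 * w * phi w ^+ 2 <= 2 * p%:R * phi w + 4 * w * dphi w) ->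
  (risk shrinkage beta <= p%:R%:E)%E.
Proof.
move=> ineq; rewrite /risk unlock.
pose Psi i y := D i y - F beta i y * (tnth y i - tnth beta i).
have iPsi i : (mvnormal beta).-integrable setT (fun y => (Psi i y)%:E).
  by have [] := stein_shrinkage beta i.
have Psi0 i : (\int[mvnormal beta]_y (Psi i y)%:E = 0)%E.
  by have [] := stein_shrinkage beta i.
have iS : (mvnormal beta).-integrable setT (fun y => \sum_(i < p) (Psi i y)%:E)%E.
  by apply: integrable_sum.
have lossE y : quadratic_loss (shrinkage y) beta = \sum_(i < p)
   (F beta i y * (tnth y i - tnth beta i) + phi (w_ y) ^+ 2 * tnth y i ^+ 2).
  by apply: eq_bigr => i _; rewrite !tnth_mktuple /F -/(w_ y); ring.
have sum_cst (c : R) : \sum_(i < p) c = c *+ p by rewrite big_const_ord iter_addr_0.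
have le y : quadratic_loss (shrinkage y) beta <= p%:R - \sum_(i < p) Psi i y.
  have -> : p%:R - \sum_(i < p) Psi i y = \sum_(i < p) (1 - Psi i y).
    by rewrite [RHS]sumrB sum_cst.
  rewrite lossE -subr_ge0 -sumrB.
  rewrite (eq_bigr (fun i => 2 * phi (w_ y) +
     (2 * dphi (w_ y) - phi (w_ y) ^+ 2) * tnth y i ^+ 2)); last first.
    by move=> i _; rewrite /Psi /D; ring.
  rewrite big_split/= sum_cst -mulr_sumr -/(sqnorm y).
  have -> : sqnorm y = 2 * w_ y by rewrite /w_ mulrC divfK.
  have := ineq _ (w_ge0 y); rewrite -mulr_natl; nra.
apply: (@le_trans _ _ (\int[mvnormal beta]_y (p%:R%:E - \sum_(i < p) (Psi i y)%:E))%E).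
  apply: ge0_le_integral => //.
  - by move=> y _; rewrite lee_fin sqnorm_ge0.
  - apply/measurable_EFinP; rewrite (funext lossE); apply: measurable_sum => i.
    apply: measurable_funD; apply: measurable_funM => //.
    + by apply: measurable_funB => //; exact: measurable_tnth.
    + by apply: measurable_funX; exact: mphi.
    + by apply: measurable_funX; exact: measurable_tnth.
  - by apply: emeasurable_funB => //; exact: measurable_int iS.
  - by move=> y _; rewrite sumEFin -EFinB lee_fin.
have ip : (mvnormal beta).-integrable setT (cst p%:R%:E) by exact: finite_measure_integrable_cst.
rewrite (integralB _ ip iS)//= integral_cst// [X in (_ * X - _)%E]probability_setT mule1.
by rewrite integral_sum// big1 ?sube0.
Qed.

End shrinkage_risk.

(** * The prior and its Bayes estimator *)

Section minimax_shrinkage.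
Context {R : realType} (p : nat).

Lemma minimax_shrinkage (delta : p.-tuple R -> p.-tuple R) (phi dphi : R -> R) :
  (forall w : R, is_derive w 1 phi (dphi w)) -> continuous dphi ->
  (forall w, 0 <= w -> `|phi w| <= 1) ->
  (forall w, 0 <= w -> `|dphi w| <= 1) ->
  (forall w, 0 <= w -> 2 * w * phi w ^+ 2 <= 2 * p%:R * phi w + 4 * w * dphi w) ->
  delta = shrinkage p phi -> minimax delta.
Proof.
move=> d cd phi1 dphi1 ineq ->; split.
  by apply: measurable_shrinkage; exact: d.
move=> delta' mdelta'; apply: le_trans (sup_risk_ge p delta' mdelta').
apply: ge_ereal_sup => _ [beta _ <-].
by apply: (risk_shrinkage_le p phi dphi).
Qed.

End minimax_shrinkage.

(** * The factor [h] of the prior and its logarithmic derivative *)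

Section prior_weight.
Context {R : realType}.
Notation mu := (@lebesgue_measure R).
Notation I01 := (`]0%R, 1%R[%classic : set R).
Variables (c3 c4 d : R).
Hypothesis c3_gt0 : 0 < c3.

Definition h_fun (x : R) : R := (1 + c3 * x) `^ c4 * expR (d * x).
Definition dlog_h (x : R) : R := c3 * c4 / (1 + c3 * x) + d.

Let base_ge1 x : 0 < x < 1 -> 1 <= 1 + c3 * x <= 1 + c3.
Proof.
move=> /andP[x0 x1]; have c0 := c3_gt0; apply/andP; split.
  by rewrite lerDl mulr_ge0// ltW.
by rewrite lerD2l ler_piMr// ltW.
Qed.

Lemma h_fun_bounds : exists2 m : R, 0 < m & exists M : R,
  forall x, 0 < x < 1 -> m <= h_fun x <= M.
Proof.
have c0 := c3_gt0; pose K := (1 + c3) `^ `|c4|.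
have K0 : 0 < K by rewrite powR_gt0// addr_gt0.
exists (K^-1 * expR (- `|d|)); first by rewrite mulr_gt0 ?invr_gt0 ?expR_gt0.
exists (K * expR `|d|) => x x01; have /andP[b1 b2] := base_ge1 x x01.
have b0 : 0 < 1 + c3 * x by rewrite (lt_le_trans ltr01).
have up e : `|e| <= `|c4| -> (1 + c3 * x) `^ e <= K.
  move=> ec; apply: (@le_trans _ _ ((1 + c3 * x) `^ `|c4|)).
    by apply: ler_powR => //; rewrite (le_trans (ler_norm _)).
  by apply: ge0_ler_powR => //; rewrite nnegrE ltW// addr_gt0.
have dx : `|d * x| <= `|d|.
  case/andP : x01 => x0 x1.
  by rewrite normrM (ger0_norm (ltW x0)) ler_piMr ?normr_ge0// ltW.
have lo : K^-1 <= (1 + c3 * x) `^ c4.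
  rewrite -[leRHS]invrK -powRN lef_pV2 ?posrE//; last exact: powR_gt0.
  by apply: up; rewrite normrN.
have elo : expR (- `|d|) <= expR (d * x).
  by rewrite ler_expR lerNl (le_trans _ dx)// -normrN ler_norm.
have eup : expR (d * x) <= expR `|d|.
  by rewrite ler_expR (le_trans (ler_norm _)).
apply/andP; split.
  by apply: ler_pM; rewrite ?expR_ge0// invr_ge0 (ltW K0).
by apply: ler_pM; rewrite ?expR_ge0 ?powR_ge0 ?up.
Qed.

Lemma h_fun_gt0 x : 0 < x < 1 -> 0 < h_fun x.
Proof. by have [m m0 [M mM]] := h_fun_bounds; move=> /mM /andP[/(lt_le_trans m0)]. Qed.

Lemma measurable_h_fun : measurable_fun setT h_fun.
Proof.
apply: measurable_funM.
  apply: (@measurableT_comp _ _ _ _ _ _ (@powR R ^~ c4)) => //.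
  by apply: measurable_funD => //; exact: measurable_funM.
by apply: measurableT_comp => //; exact: measurable_funM.
Qed.

Lemma bm_h_fun : bounded_measurable01 h_fun.
Proof.
split; first exact: measurable_funTS measurable_h_fun.
have [m m0 [M mM]] := h_fun_bounds; exists M => x x01.
by rewrite ger0_norm ?(ltW (h_fun_gt0 _ x01))//; have /andP[] := mM x x01.
Qed.

Lemma is_derive_affine (c x : R) : is_derive x 1 (fun x => 1 + c * x) c.
Proof.
have := @is_deriveD _ _ _ _ _ _ _ _ _ (@is_derive_cst _ _ _ (1 : R) x 1)
  (@is_deriveZ _ _ _ _ c _ _ _ (is_derive_id x 1)).
by rewrite /GRing.scale/= add0r mulr1.
Qed.

Lemma is_derive_h_fun (x : R) : 0 < x < 1 -> is_derive x 1 h_fun (dlog_h x * h_fun x).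
Proof.
move=> x01; have /andP[b1 _] := base_ge1 x x01.
have b0 : 0 < 1 + c3 * x by rewrite (lt_le_trans ltr01).
have d1 := @is_derive1_comp _ (@powR R ^~ c4) (fun x => 1 + c3 * x) x _ _
  (is_derive_powR c4 _ b0) (is_derive_affine c3 x).
have d0 : is_derive x 1 (fun x => d * x) d.
  by rewrite -[X in is_derive _ _ _ X]mulr1; apply: is_deriveZ.
have d2 := @is_derive1_comp _ expR (fun x => d * x) x _ _ (is_derive_expR _) d0.
have dd := @is_deriveM _ _ _ _ _ _ _ _ d1 d2.
apply: (is_derive_eq dd); rewrite /GRing.scale/= /dlog_h /h_fun.
have -> : (1 + c3 * x) `^ c4 = (1 + c3 * x) * (1 + c3 * x) `^ (c4 - 1).
  by rewrite powRB ?(gt_eqF b0) ?implybT// powRr1 ?ltW// mulrCA divff ?mulr1 ?gt_eqF.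
by field; rewrite gt_eqF.
Qed.

Lemma continuous_dlog_h (x : R) : 0 < x < 1 -> {for x, continuous dlog_h}.
Proof.
move=> x01; have /andP[b1 _] := base_ge1 x x01.
apply: cvgD; last exact: cvg_cst.
apply: cvgM; first exact: cvg_cst.
apply: cvgV; first by rewrite gt_eqF// (lt_le_trans ltr01).
by apply: cvgD; [exact: cvg_cst|apply: cvgM; [exact: cvg_cst|exact: cvg_id]].
Qed.

Lemma bm_dlog_h : bounded_measurable01 dlog_h.
Proof.
split.
  apply: open_continuous_measurable_fun => // x.
  by rewrite inE/= in_itv/=; exact: continuous_dlog_h.
exists (`|c3 * c4| + `|d|) => x x01; have /andP[b1 _] := base_ge1 x x01.
have b0 : 0 < 1 + c3 * x by rewrite (lt_le_trans ltr01).
rewrite (le_trans (ler_normD _ _))// lerD2r normrM ler_piMr//.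
rewrite ger0_norm; last by rewrite invr_ge0 ltW.
by rewrite invf_le1.
Qed.

(** The difference quotient of [x * dlog_h x] is affine in q = 1 / ((1 + c3 x)(1 + c3 y)), so its
    sign is decided at the ends of the range of q. The two ends produce the two bounds on [c4] in
    the theorem. *)
Lemma xdlog_h_diff (x y : R) : 0 <= x -> x <= y -> y <= 1 ->
  exists2 q, (1 + c3) ^- 2 <= q <= 1 &
    y * dlog_h y - x * dlog_h x = (y - x) * (d + c3 * c4 * q).
Proof.
move=> x0 xy y1; have c0 := c3_gt0.
have cx : 0 <= c3 * x by rewrite mulr_ge0// ltW.
have cxy : c3 * x <= c3 * y by rewrite ler_pM2l.
have cy : c3 * y <= c3 by rewrite ler_piMr// ltW.
have x1 : 0 < 1 + c3 * x by rewrite ltr_pwDl.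
have y1' : 0 < 1 + c3 * y by lra.
have xy0 : 0 < (1 + c3 * x) * (1 + c3 * y) by exact: mulr_gt0.
have sq0 : 0 < (1 + c3) ^+ 2 by rewrite exprn_gt0// addr_gt0.
exists ((1 + c3 * x) * (1 + c3 * y))^-1.
  apply/andP; split; last by rewrite invf_le1//; nra.
  by rewrite lef_pV2 ?posrE// expr2; apply: ler_pM; lra.
by rewrite /dlog_h; field; rewrite !gt_eqF.
Qed.

Lemma dlog_h1 : 1 * dlog_h 1 = d + c3 * c4 / (1 + c3).
Proof. by rewrite /dlog_h mulr1 mul1r addrC. Qed.

(** For [0 <= d] the decisive end is q = (1 + c3)^(-2), for [d < 0] it is q = 1; in the
    nondecreasing case the roles are exchanged. *)
Lemma xdlog_h_nonincreasing :
  0 <= d /\ c4 <= - ((c3 + 1) ^+ 2 * d / c3) \/ d < 0 /\ c4 <= - (d / c3) ->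
  forall x y, 0 <= x -> x <= y -> y <= 1 -> y * dlog_h y <= x * dlog_h x.
Proof.
move=> H x y x0 xy y1; have c0 := c3_gt0.
have [q /andP[q1 q2] E] := xdlog_h_diff x y x0 xy y1.
rewrite -subr_le0 E; apply: mulr_ge0_le0; first by rewrite subr_ge0.
have K0 : 0 < (1 + c3) ^+ 2 by rewrite exprn_gt0// addr_gt0.
have Kq : 1 <= (1 + c3) ^+ 2 * q by rewrite -ler_pdivrMl// mulr1.
have q0 : 0 <= q by rewrite (le_trans _ q1)// invr_ge0 ltW.
case: H => -[d0 Hc].
  have h1 : c3 * c4 <= - ((1 + c3) ^+ 2 * d).
    have := Hc; rewrite -(ler_pM2l c3_gt0) mulrN mulrCA divff ?gt_eqF// mulr1.
    by rewrite [c3 + 1]addrC.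
  by nra.
have h1 : c3 * c4 <= - d.
  by have := Hc; rewrite -(ler_pM2l c3_gt0) mulrN mulrCA divff ?gt_eqF// mulr1.
by nra.
Qed.

Lemma xdlog_h_nondecreasing :
  0 <= d /\ - (d / c3) <= c4 \/ d < 0 /\ - ((c3 + 1) ^+ 2 * d / c3) < c4 ->
  forall x y, 0 <= x -> x <= y -> y <= 1 -> x * dlog_h x <= y * dlog_h y.
Proof.
move=> H x y x0 xy y1; have c0 := c3_gt0.
have [q /andP[q1 q2] E] := xdlog_h_diff x y x0 xy y1.
rewrite -subr_ge0 E; apply: mulr_ge0; first by rewrite subr_ge0.
have K0 : 0 < (1 + c3) ^+ 2 by rewrite exprn_gt0// addr_gt0.
have Kq : 1 <= (1 + c3) ^+ 2 * q by rewrite -ler_pdivrMl// mulr1.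
have q0 : 0 <= q by rewrite (le_trans _ q1)// invr_ge0 ltW.
case: H => -[d0 Hc].
  have h1 : - d <= c3 * c4.
    by have := Hc; rewrite -(ler_pM2l c3_gt0) mulrN mulrCA divff ?gt_eqF// mulr1.
  by nra.
have h1 : - ((1 + c3) ^+ 2 * d) <= c3 * c4.
  have := ltW Hc; rewrite -(ler_pM2l c3_gt0) mulrN mulrCA divff ?gt_eqF// mulr1.
  by rewrite [c3 + 1]addrC.
by nra.
Qed.

End prior_weight.

(** * The Bayes estimator as a shrinkage estimator *)

Section posterior.
Context {R : realType} (p : nat).
Notation mu := (@lebesgue_measure R).
Notation I01 := (`]0%R, 1%R[%classic : set R).
Variables (a b c3 c4 d : R).
Hypotheses (b_gt0 : 0 < b) (b_lt1 : b < 1) (c3_gt0 : 0 < c3).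
Notation h := (h_fun c3 c4 d).
Notation pi := (prior a b c3 c4 d).

Lemma posterior_integralE (e s : R) (y : p.-tuple R) : s = e + a ->
  (posterior_integral pi e y = \int[mu]_(k in I01)
    (beta_weight s b k * (h k * expR (- (k * (sqnorm y / 2))) * 1))%:E)%E.
Proof.
move=> ->; apply: eq_integral => k; rewrite inE/= in_itv/= => /andP[k0 k1].
congr EFin; rewrite /prior /beta_weight -/(h_fun c3 c4 d k).
have -> : k `^ (e + a - 1) = k `^ e * k `^ (a - 1).
  by rewrite -powRD ?addrA// (gt_eqF k0) implybT.
have -> : - k * sqnorm y / 2 = - (k * (sqnorm y / 2)) by rewrite mulNr mulNr mulrA.
by ring.
Qed.

Lemma posterior_integral_fin (e s : R) (y : p.-tuple R) : s = e + a -> 0 < s ->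
  posterior_integral pi e y = (tilt s b h (sqnorm y / 2) (fun=> 1))%:E.
Proof.
move=> se s0; rewrite (posterior_integralE _ _ _ se) /tilt /Rintegral fineK//.
apply: integrable_fin_num => //.
exact: (integrable_tilt s b h s0 b_gt0 (bm_h_fun c3 c4 d c3_gt0) _ _ (bm01_cst 1)).
Qed.

(** Since [b < 1], the factor in [1 - k] is at least 1, and [h] and the exponential are bounded
    below. The remaining power gives both positivity for s > 0 and divergence for s = 0. *)
Lemma posterior_weight_ge (s w : R) : exists2 c : R, 0 < c & forall k, 0 < k < 1 ->
  c * k `^ (s - 1) <= beta_weight s b k * (h k * expR (- (k * w)) * 1).
Proof.
have [m m0 [M hM]] := h_fun_bounds c3 c4 d c3_gt0.
exists (m * expR (- `|w|)); first by rewrite mulr_gt0 ?expR_gt0.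
move=> k k01; have /andP[mh _] := hM k k01; have /andP[k0 k1] := k01.
rewrite mulr1 /beta_weight [leLHS]mulrC -[leRHS]mulrA.
apply: ler_wpM2l; first exact: powR_ge0.
have e1 : expR (- `|w|) <= expR (- (k * w)).
  rewrite ler_expR lerN2 (le_trans (ler_norm _))// normrM (ger0_norm (ltW k0)).
  by rewrite ler_piMl ?normr_ge0// ltW.
have b1 : 1 <= (1 - k) `^ (b - 1).
  rewrite -[leLHS](powRr0 (1 - k)); apply: ger_powR; last by rewrite subr_le0 ltW.
  by apply/andP; split; lra.
rewrite -[leLHS]mul1r; apply: ler_pM => //; first by rewrite mulr_ge0 ?expR_ge0 ?ltW.
by apply: ler_pM; rewrite ?expR_ge0// ltW.
Qed.

Lemma moment0_gt0 (s w : R) : 0 < s -> 0 < moment s b h w 0.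
Proof.
move=> s0; have [c c0 hc] := posterior_weight_ge s w.
have [ip ep] := integral_powR01 s s0.
apply: (@lt_le_trans _ _ (c * s^-1)); first by rewrite mulr_gt0 ?invr_gt0.
rewrite -ep -RintegralZl//; apply: le_Rintegral => //.
- by apply: eq_integrable (integrableZl _ c ip) => //; exact: measurable_itv.
- exact: (integrable_tilt s b h s0 b_gt0 (bm_h_fun c3 c4 d c3_gt0) _ _ (bm01_exprn 0)).
Qed.

(* [k ^ (-1)] dominates every [k ^ (s - 1)], whose integral is [1 / s]. *)
Lemma posterior_integral_infty (e : R) (y : p.-tuple R) : e + a = 0 ->
  posterior_integral pi e y = +oo%E.
Proof.
move=> ea; rewrite (posterior_integralE _ 0 _ (esym ea)); apply/eqyP => A A0.
have [c c0 hc] := posterior_weight_ge 0 (sqnorm y / 2).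
(* Makes the lower bound c / s equal to [A]. *)
pose s := c / A; have s0 : 0 < s by rewrite divr_gt0.
have [ip ep] := integral_powR01 s s0.
have bw k : 0 < k < 1 -> c * k `^ (s - 1) <= beta_weight 0 b k *
    (h k * expR (- (k * (sqnorm y / 2))) * 1).
  move=> k01; apply: le_trans (hc k k01); rewrite ler_pM2l//.
  have /andP[k0 /ltW k1] := k01; apply: ger_powR; first by rewrite k0.
  by rewrite lerD2r ltW.
apply: (@le_trans _ _ (\int[mu]_(k in I01) (c%:E * (k `^ (s - 1))%:E))%E).
  rewrite integralZl//.
  rewrite -[X in (_ <= _ * X)%E]fineK; last by apply: integrable_fin_num ip.
  rewrite -[fine _]/(Rintegral _ _ _) ep -EFinM lee_fin /s invf_div mulrCA.
  by rewrite divff ?mulr1 ?gt_eqF.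
apply: ge0_le_integral => //.
- by move=> k _; rewrite mule_ge0 ?lee_fin ?powR_ge0 ?ltW.
- apply/measurable_EFinP; apply: measurable_funM => //.
  by apply: measurable_funTS; exact: measurable_powR.
- apply/measurable_EFinP; apply: measurable_funM.
    by apply: measurable_funTS; exact: measurable_beta_weight.
  apply: measurable_funM => //; apply: measurable_funM.
    by apply: measurable_funTS; exact: measurable_h_fun.
  by have [] := @bm01_expR R (sqnorm y / 2).
Qed.

Definition mean_weight (s w : R) := moment s b h w 1 / moment s b h w 0.

(** Minus the posterior variance of [k]. *)
Definition dmean_weight (s w : R) :=
  (moment s b h w 1 ^+ 2 - moment s b h w 2 * moment s b h w 0) / moment s b h w 0 ^+ 2.

Lemma bayes_estimator_shrinkage (s : R) : s = p%:R / 2 + a -> 0 < s ->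
  bayes_estimator (p := p) pi = shrinkage p (mean_weight s).
Proof.
move=> se s0; apply/funext => y; apply: eq_from_tnth => i.
rewrite !tnth_mktuple; congr ((1 - _) * _).
(* One more power of [k] raises the shape [s] by 1, which is the moment of order 1 at the original
   shape. *)
have sS : s + 1 = p%:R / 2 + 1 + a by rewrite se addrAC.
rewrite (posterior_integral_fin _ _ _ sS) ?addr_gt0//.
rewrite (posterior_integral_fin _ _ _ se) //.
have m0 := moment0_gt0 s (sqnorm y / 2) s0.
have -> : tilt s b h (sqnorm y / 2) (fun=> 1) = moment s b h (sqnorm y / 2) 0.
  by apply: eq_tilt => x _; rewrite expr0.
have -> : tilt (s + 1) b h (sqnorm y / 2) (fun=> 1) = moment s b h (sqnorm y / 2) 1.
  apply: eq_Rintegral => x; rewrite inE/= in_itv/= => /andP[x0 _].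
  by rewrite beta_weightS// expr1; ring.
by rewrite inver gt_eqF.
Qed.

(** The denominator diverges while the numerator, of shape 1, is finite: the ratio is 0. *)
Lemma bayes_estimator_id : p%:R / 2 + a = 0 ->
  bayes_estimator (p := p) pi = shrinkage p (cst 0).
Proof.
move=> pa; apply/funext => y; apply: eq_from_tnth => i.
rewrite !tnth_mktuple; congr ((1 - _) * _).
have s1 : 1 = p%:R / 2 + 1 + a by rewrite addrAC pa add0r.
by rewrite (posterior_integral_fin _ _ _ s1)// (posterior_integral_infty _ _ pa) invey mule0.
Qed.

(** For phi = m_1 / m_0 the risk condition, multiplied by m_0^2 / 2, is the moment inequality. *)
Lemma minimax_of_moment_inequality (s : R) : s = p%:R / 2 + a -> 0 < s ->
  (forall w, 0 <= w ->
     w * (2 * moment s b h w 2 * moment s b h w 0 - moment s b h w 1 ^+ 2) <=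
       p%:R * moment s b h w 0 * moment s b h w 1) ->
  minimax (bayes_estimator (p := p) pi).
Proof.
move=> se s0 ineq; have bh := bm_h_fun c3 c4 d c3_gt0.
have h0 (x : R) : 0 < x < 1 -> 0 <= h x by move=> x01; apply/ltW/h_fun_gt0.
pose m w n := moment s b h w n.
have m0 w : 0 < m w 0 by exact: moment0_gt0.
have dm (w : R) n : is_derive w 1 (m ^~ n) (- m w n.+1).
  exact: (is_derive_moment s b h s0 b_gt0 bh).
have mS w n : m w n.+1 <= m w n by exact: (moment_leS s b h s0 b_gt0 bh h0).
have mge0 w n : 0 <= m w n by exact: (moment_ge0 s b h h0).
have cm n : continuous (m ^~ n).
  by move=> w; apply/differentiable_continuous/derivable1_diffP; have [] := dm w n.
have dphi (w : R) : is_derive w 1 (mean_weight s) (dmean_weight s w).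
  have dV := @is_deriveV _ (m ^~ 0%N) w _ _ (lt0r_neq0 (m0 w)) (dm w 0%N).
  have := @is_deriveM _ _ _ _ _ _ _ _ (dm w 1%N) dV.
  rewrite /GRing.scale/= => D; apply: (is_derive_eq D).
  by rewrite /dmean_weight -!/(m _ _); field; rewrite gt_eqF.
apply: (minimax_shrinkage p _ (mean_weight s) (dmean_weight s)) => //.
- have cm2 n : continuous (fun w => m w n ^+ 2).
    rewrite (_ : (fun w => _) = fun w => m w n * m w n); last first.
      by apply/funext => w; rewrite expr2.
    by move=> w; apply: cvgM; exact: cm.
  move=> w; apply: cvgM.
    by apply: cvgB; [exact: cm2|apply: cvgM; exact: cm].
  by apply: cvgV; [rewrite expf_neq0// gt_eqF//|exact: cm2].
- move=> w _; rewrite /mean_weight -!/(m _ _) ger0_norm ?divr_ge0//.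
  by rewrite ler_pdivrMr// mul1r.
(* As m_2 <= m_1 <= m_0, both m_1^2 and m_2 m_0 lie between 0 and m_0^2. *)
- move=> w _; rewrite /dmean_weight -!/(m _ _) normrM [X in _ * X]ger0_norm; last first.
    by rewrite invr_ge0 sqr_ge0.
  rewrite ler_pdivrMr ?exprn_gt0// mul1r ler_norml.
  have := mS w 0%N; have := mS w 1%N; have := mge0 w 1%N; have := mge0 w 2%N.
  have := m0 w; move: (m w 0%N) (m w 1%N) (m w 2%N) => x0 x1 x2 h1 h2 h3 h4 h5.
  by apply/andP; split; nra.
- move=> w w0; have := ineq w w0.
  rewrite /mean_weight /dmean_weight -!/(m _ _) => I.
  have m02 : 0 < m w 0%N ^+ 2 by rewrite exprn_gt0.
  rewrite -(ler_pM2r m02).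
  rewrite [leLHS](_ : _ = 2 * (w * m w 1%N ^+ 2)); last by field; rewrite gt_eqF.
  rewrite [leRHS](_ : _ = 2 * (p%:R * m w 0%N * m w 1%N) +
    4 * (w * (m w 1%N ^+ 2 - m w 2%N * m w 0%N))); last by field; rewrite gt_eqF.
  lra.
- exact: bayes_estimator_shrinkage.
Qed.

Lemma minimax_of_infinite_mass : p%:R / 2 + a = 0 ->
  minimax (bayes_estimator (p := p) pi).
Proof.
move=> pa; apply: (minimax_shrinkage p _ (cst 0) (cst 0)).
- by move=> w; exact: cvg_cst.
- by move=> w _; rewrite /cst normr0.
- by move=> w _; rewrite /cst normr0.
- by move=> w _; rewrite /cst expr0n/= !mulr0 addr0.
- exact: bayes_estimator_id.
Qed.

End posterior.

Theorem corollary4p2 (R : realType) (p : nat) (a b c3 c4 d : R)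
    (p_gt0 : (0 < p)%N)
    (a_ge : - (p%:R / 2) <= a) (a_lt : a < p%:R / 2 - 2) (a_lt1 : a < 1)
    (b_gt0 : 0 < b) (b_lt1 : b < 1) (c3_gt0 : 0 < c3) :
  ((0 <= d /\ c4 <= - ((c3 + 1) ^+ 2 * d / c3) \/ d < 0 /\ c4 <= - (d / c3)) ->
   - (p%:R / 2 - a - 2) <= d + c3 * c4 / (1 + c3) ->
   (p%:R + 2 * a + 2) / (3 * p%:R / 2 + a) <= b ->
   minimax (bayes_estimator (p := p) (prior a b c3 c4 d))) /\
  ((0 <= d /\ - (d / c3) <= c4 \/ d < 0 /\ - ((c3 + 1) ^+ 2 * d / c3) < c4) ->
   d + c3 * c4 / (1 + c3) <= (p%:R / 2 - a - 2) / 2 ->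
   (p%:R + 2 * a + 2 + 2 * (d + c3 * c4 / (1 + c3))) / (3 * p%:R / 2 + a) <= b ->
   minimax (bayes_estimator (p := p) (prior a b c3 c4 d))).
Proof.
have p0 : 0 < p%:R :> R by rewrite ltr0n.
(* The lower bound on [a] says that the shape p/2 + a is nonnegative; at 0 the mass is infinite. *)
have [s0|s0] : 0 < p%:R / 2 + a \/ p%:R / 2 + a = 0.
- by have [?|?|?] := ltgtP 0 (p%:R / 2 + a); [left|lra|right].
- have den0 : 0 < 3 * p%:R / 2 + a by lra.
  pose s := p%:R / 2 + a.
  have bh := bm_h_fun c3 c4 d c3_gt0; have bg := bm_dlog_h c3 c4 d c3_gt0.
  have h0 (x : R) : 0 < x < 1 -> 0 <= h_fun c3 c4 d x.
    by move=> x01; apply/ltW/h_fun_gt0.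
  have dh := is_derive_h_fun c3 c4 d c3_gt0.
  have cg := continuous_dlog_h c3 c4 d c3_gt0.
  have G1 := dlog_h1 c3 c4 d.
  split=> H Hg; rewrite ler_pdivrMr// => Hb.
  (* [x * dlog_h x] vanishes at 0 and is monotone, so its values lie between 0 and the one at 1,
     which is d + c3 c4 / (1 + c3). *)
  + have mono := xdlog_h_nonincreasing c3 c4 d c3_gt0 H.
    apply: (minimax_of_moment_inequality p a b c3 c4 d b_gt0 b_lt1 c3_gt0 s) => // w w0.
    apply: (moment_inequality_nonpos s b _ (dlog_h c3 c4 d) s0 b_gt0 b_lt1 bh bg h0 dh cg
      _ (- (1 * dlog_h c3 c4 d 1))) => //.
    * move=> x /andP[/ltW x0 /ltW x1]; rewrite opprK mono//=.
      by have := mono 0 x (lexx _) x0 x1; rewrite mul0r.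
    * by rewrite oppr_ge0; have := mono 0 1 (lexx _) ler01 (lexx _); rewrite mul0r.
    * by move=> x y /ltW x0 xy /ltW y1; exact: mono.
    * by rewrite G1 /s; lra.
    * by rewrite /s; lra.
    * exact: moment0_gt0.
  + have mono := xdlog_h_nondecreasing c3 c4 d c3_gt0 H.
    apply: (minimax_of_moment_inequality p a b c3 c4 d b_gt0 b_lt1 c3_gt0 s) => // w w0.
    apply: (moment_inequality_nonneg s b _ (dlog_h c3 c4 d) s0 b_gt0 b_lt1 bh bg h0 dh cg
      _ (1 * dlog_h c3 c4 d 1)) => //.
    * move=> x /andP[/ltW x0 /ltW x1]; rewrite mono// andbT.
      by have := mono 0 x (lexx _) x0 x1; rewrite mul0r.
    * by have := mono 0 1 (lexx _) ler01 (lexx _); rewrite mul0r.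
    * by rewrite G1 /s; lra.
    * by rewrite G1 /s; lra.
by split=> *; exact: minimax_of_infinite_mass.
Qed.
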